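(* For any real analytic tube hypersurface $v=F(x)$, $F(x)=x^k+o(x^k)$, $k>2$, the complete t-normal form is convergent and preserves the tubular symmetries. That is, the unique formal transformation $z^*=z+f(z,w)$, $w^*=w+g(z,w)$, with $f$ containing only terms of weight $>1$ and $g$ only terms of weight $>k$, which takes the hypersurface into t-normal form, is given by convergent power series, and the resulting hypersurface is again a real analytic tube $v^*=F^*(x^* )$.
   Context: Coordinates in $\mathbb C^2$ are $(z,w)$ with $z=x+iy$, $w=u+iv$ (and similarly with stars). The variables $z,x,y$ have weight $1$ and $w,u$ have weight $k$. A hypersurface written as $$v=x^k+\sum_{j,l}X_{j,l}(u)x^jy^l,\qquad X_{j,l}(u)=\sum_mA_{j,l,m}u^m\quad (A_{j,l,m}=0 \text{ unless } j+l+km\ge k+1),$$ is in t-normal form if $X_{0,j}=X_{1,j}=X_{k-1,j}=X_{k,j}=0$ for all $j=0,1,2,\dots$ and $X_{2k-1,0}=X_{2k-1,1}=0$. For every such hypersurface (even formal) there is a unique formal transformation of the form described in the claim taking it into t-normal form. *)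

(* Defs.v *)
From HB Require Import structures.
From mathcomp Require Import all_boot all_order all_algebra.
From mathcomp Require Import complex.
From mathcomp Require Import all_classical all_reals all_analysis.

Set Implicit Arguments.
Unset Strict Implicit.
Unset Printing Implicit Defensive.

Import Order.TTheory GRing.Theory Num.Theory numFieldNormedType.Exports.

Local Open Scope ring_scope.
Local Open Scope complex_scope.
Local Open Scope classical_set_scope.

(* Formal power series are coefficient functions: [f a b] is the coefficient of
   z^a w^b, and [P j l m] is the coefficient of x^j y^l u^m. *)
Definition fps2 (T : Type) := nat -> nat -> T.
Definition fps3 (T : Type) := nat -> nat -> nat -> T.

Section FormalSeries.
Variable T : comNzRingType.

Definition mono3 (j l m : nat) : fps3 T :=
  fun j' l' m' => [&& j' == j, l' == l & m' == m]%:R.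

Definition add3 (P Q : fps3 T) : fps3 T := fun j l m => P j l m + Q j l m.

Definition scale3 (c : T) (P : fps3 T) : fps3 T := fun j l m => c * P j l m.

Definition mul3 (P Q : fps3 T) : fps3 T := fun j l m =>
  \sum_(p < j.+1) \sum_(q < l.+1) \sum_(r < m.+1)
    P p q r * Q (j - p)%N (l - q)%N (m - r)%N.

Definition exp3 (P : fps3 T) (n : nat) : fps3 T := iter n (mul3 P) (mono3 0 0 0).

(* Substitutions f(Z, W) and P(X, Y, U).  They are meant for series Z, W, X, Y, U
   without constant term: then Z^a W^b has no term of degree < a + b, so the
   coefficient of x^j y^l u^m only involves exponents a, b <= j + l + m and the
   truncated sum is the exact coefficient. *)
Definition subst2 (f : fps2 T) (Z W : fps3 T) : fps3 T := fun j l m =>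
  \sum_(a < (j + l + m).+1) \sum_(b < (j + l + m).+1)
    f a b * mul3 (exp3 Z a) (exp3 W b) j l m.

Definition subst3 (P : fps3 T) (X Y U : fps3 T) : fps3 T := fun j l m =>
  \sum_(a < (j + l + m).+1) \sum_(b < (j + l + m).+1) \sum_(c < (j + l + m).+1)
    P a b c * mul3 (exp3 X a) (mul3 (exp3 Y b) (exp3 U c)) j l m.

End FormalSeries.

Section Hypersurfaces.
Variable R : realType.

Definition re3 (P : fps3 R[i]) : fps3 R := fun j l m => complex.Re (P j l m).
Definition im3 (P : fps3 R[i]) : fps3 R := fun j l m => complex.Im (P j l m).
Definition toC3 (P : fps3 R) : fps3 R[i] := fun j l m => (P j l m)%:C.

(* A formal hypersurface v = P(x,y,u) is represented by the series P.  The next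
   two series are the restrictions to it of z = x + iy and w = u + iv, expressed
   in the parameters (x,y,u). *)
Definition restr_z : fps3 R[i] := add3 (mono3 _ 1 0 0) (scale3 (0 +i* 1) (mono3 _ 0 1 0)).
Definition restr_w (P : fps3 R) : fps3 R[i] :=
  add3 (mono3 _ 0 0 1) (scale3 (0 +i* 1) (toC3 P)).

(* (z,w) |-> (z + f(z,w), w + g(z,w)) takes v = P(x,y,u) into
   v' = Q(x',y',u'), as an identity of formal power series in (x,y,u). *)
Definition takes_into (f g : fps2 R[i]) (P Q : fps3 R) : Prop :=
  let Z := restr_z in
  let W := restr_w P in
  let Z' := add3 Z (subst2 f Z W) in
  let W' := add3 W (subst2 g Z W) in
  im3 W' = subst3 Q (re3 Z') (im3 Z') (re3 W').

(* Only terms of weight > s, where z has weight 1 and w has weight k. *)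
Definition weight_gt (k s : nat) (f : fps2 R[i]) : Prop :=
  forall a b, f a b != 0 -> (s < a + k * b)%N.

(* The hypersurface v = x^k + sum A_{j,l,m} x^j y^l u^m. *)
Definition hypersurface (k : nat) (A : fps3 R) : fps3 R := add3 (mono3 _ k 0 0) A.

Definition t_normal_form (k : nat) (A : fps3 R) : Prop :=
  [/\ forall j l m, A j l m != 0 -> (k + 1 <= j + l + k * m)%N,
      forall j m, [/\ A 0%N j m = 0, A 1%N j m = 0,
                      A (k - 1)%N j m = 0 & A k j m = 0]
    & forall m, A (2 * k - 1)%N 0%N m = 0 /\ A (2 * k - 1)%N 1%N m = 0].

(* (f, g) is a formal transformation z' = z + f, w' = w + g of the admissible
   form taking v = P into v' = x'^k + A, which is in t-normal form. *)
Definition normalizes (k : nat) (P : fps3 R) (f g : fps2 R[i]) (A : fps3 R) : Prop :=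
  [/\ weight_gt k 1 f, weight_gt k k g, t_normal_form k A
    & takes_into f g P (hypersurface k A)].

(* Absolute convergence in some polydisc centred at the origin. *)
Definition convergent2 (f : fps2 R[i]) : Prop :=
  exists2 r : R, 0 < r &
    forall z w : R[i],
      ComplexField.Normc.normc z < r -> ComplexField.Normc.normc w < r ->
      summable [set: nat * nat]
        (fun p => (ComplexField.Normc.normc (f p.1 p.2 * z ^+ p.1 * w ^+ p.2))%:E).

(* F is real analytic at 0, with power series expansion sum a_n x^n. *)
Definition analytic_at0_with (F : R -> R) (a : nat -> R) : Prop :=
  exists2 r : R, 0 < r &
    forall x : R, `|x| < r -> pseries a x @ \oo --> F x.

(* The tube v = sum a_n x^n, as a series in (x,y,u). *)
Definition tube (a : nat -> R) : fps3 R :=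
  fun j l m => if (l == 0)%N && (m == 0)%N then a j else 0.

End Hypersurfaces.

(* Main.v *)
Require Import Defs.
From HB Require Import structures.
From mathcomp Require Import all_boot all_order all_algebra.
From mathcomp Require Import complex.
From mathcomp Require Import all_classical all_reals all_analysis.
From mathcomp Require Import ring lra zify.

Set Implicit Arguments.
Unset Strict Implicit.
Unset Printing Implicit Defensive.

Import Order.TTheory GRing.Theory Num.Theory numFieldNormedType.Exports.

(** The affine map (z, w) |-> (z + i beta w, w), with beta real, sends a tube
    v = F(x) to a tube: on it the new x is x - beta F(x), while v is unchanged,
    so that v = b(x) with b(x - beta F(x)) = F(x).  Since F(x) = x^k + ..., the
    only condition of the t-normal form that a tube x^k + ... can violate is the
    vanishing of the coefficient of x^(2k-1), and the map adds k beta to that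
    coefficient; beta = - a_(2k-1) / k achieves the normal form
    ([normalizes_tube]).

    Convergence.  Equivalently b(t) = F(t + beta b(t)) ([tube_coef_eq],
    [tube_coef_comp]).  The coefficients of b are produced by iterating this
    equation on polynomials modulo growing powers of the variable, and the same
    iteration with F and beta replaced by their absolute values gives a
    majorant whose value at a small r stays below r, because F vanishes to
    order at least 2 ([tube_coef_bound]).

    Uniqueness.  Two normalizing maps are compared weight by weight.  Suppose
    that (f, g, A) and (f', g', A') agree up to weights s, k + s - 1 and
    k + s - 1.  The part of weight k + s of the difference of the two identities
    is linear in the first differences df, dg, dA:
      Im dg(z, u + i x^k) = k x^(k-1) Re df(z, u + i x^k) + dA(x, y, u),
    and the conditions on A are exactly what makes this force df = dg = dA = 0
    ([model_kernel]): the coefficients of x^0 and x^1 show that dg is a real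
    series in w, those of x^(k-1) and x^k that df = z dg'(w) / k + i psi(w) with
    psi real, and those of x^(2k-1) y^0 and x^(2k-1) y^1 that psi' = dg'' = 0;
    what is left is excluded by the weights.  Induction on s concludes
    ([normalizes_unique]).

    That F(x) - x^k = o(x^k) determines the coefficients of F up to order k is
    [analytic_tangent_coef]. *)

Local Open Scope ring_scope.
Local Open Scope complex_scope.

(** * Composition of polynomials modulo powers of the variable *)

Section PolyModX.
Variable R : fieldType.
Implicit Types p q c e : {poly R}.

Lemma dvdXnP n p : reflect (forall i, (i < n)%N -> p`_i = 0) ('X^n %| p).
Proof.
apply: (iffP idP) => [/dvdpP[q ->] i lt_in|p0]; first by rewrite coefMXn lt_in.
suff -> : p = drop_poly n p * 'X^n by apply: dvdp_mull.
rewrite -{1}(poly_take_drop n p) [X in X + _](_ : _ = 0) ?add0r //.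
by apply/polyP => i; rewrite coef_take_poly coef0; case: ifP => // /p0.
Qed.

Lemma dvdp_comp_sub p c e : c - e %| (p \Po c) - (p \Po e).
Proof.
elim/poly_ind: p => [|p x IH]; first by rewrite !comp_poly0 subrr dvdp0.
rewrite !comp_polyD !comp_polyM !comp_polyX !comp_polyC opprD addrACA subrr addr0.
have -> : (p \Po c) * c - (p \Po e) * e = ((p \Po c) - (p \Po e)) * c + (c - e) * (p \Po e) by ring.
by rewrite dvdp_add ?dvdp_mulr ?dvdp_mulIl//.
Qed.

Lemma dvdXn_comp n p c : 'X %| c -> 'X^n %| p -> 'X^n %| p \Po c.
Proof.
move=> Xc /dvdpP[q ->]; rewrite comp_polyM comp_Xn_poly dvdp_mull //.
exact: dvdp_exp2r.
Qed.

(** Since p has order at least 2, its derivative vanishes at 0: composing with p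
    gains one order of agreement.  This makes the iteration below converge. *)
Lemma dvdXn_comp_contract n p c e :
    'X^2 %| p -> 'X %| c -> 'X %| e -> 'X^n %| c - e ->
  'X^(n.+1) %| (p \Po c) - (p \Po e).
Proof.
move=> /dvdpP[q ->] Xc Xe Xce; rewrite !(comp_polyM q) !comp_Xn_poly.
have -> : (q \Po c) * c ^+ 2 - (q \Po e) * e ^+ 2 =
  (c * c) * ((q \Po c) - (q \Po e)) + ((c - e) * (c + e)) * (q \Po e) by ring.
apply: dvdp_add.
  rewrite exprS -mulrA; apply: dvdp_mul => //; apply: dvdp_mull.
  exact: dvdp_trans Xce (dvdp_comp_sub _ _ _).
by apply: dvdp_mulr; rewrite exprSr; apply: dvdp_mul => //; apply: dvdp_add.
Qed.

(** As (X e)^m = X^m e^m with e nonzero at 0, the lowest term of p survives the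
    composition. *)
Lemma dvdXn_comp_inj n p e : e`_0 != 0 ->
  'X^n %| p \Po ('X * e) -> 'X^n %| p.
Proof.
move=> e0; elim: n => [|n IH] pe; first by rewrite expr0 dvd1p.
have /IH/dvdpP[q pq] : 'X^n %| p \Po ('X * e).
  by apply: dvdp_trans pe; apply: dvdp_exp2l.
have comp_p : p \Po ('X * e) = (e ^+ n * (q \Po ('X * e))) * 'X^n.
  by rewrite pq comp_polyM comp_Xn_poly exprMn; ring.
move: pe; rewrite comp_p pq exprS !dvdp_mul2r ?expf_neq0 ?polyX_eq0 //.
rewrite -['X]subr0 -polyC0 !dvdp_XsubCl !rootE hornerM horner_comp horner_exp.
rewrite hornerM hornerD hornerX hornerN hornerC subr0 mul0r mulf_eq0 expf_eq0.
by rewrite -!horner_coef0 in e0 *; rewrite (negPf e0) andbF.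
Qed.
End PolyModX.

(** * The implicit equation b(t) = a(t + beta b(t)) *)

Section TubeSeries.
Variable R : realFieldType.
Implicit Types (a : nat -> R) (beta : R) (p q c e : {poly R}).

Definition trunc n a : {poly R} := \poly_(i < n) a i.

Lemma dvdXn_trunc n m a : (n <= m)%N -> 'X^n %| trunc m a - trunc n a.
Proof.
move=> nm; apply/dvdXnP => i lt_in.
by rewrite coefB !coef_poly lt_in (leq_trans lt_in nm) subrr.
Qed.

Lemma dvdXn_trunc0 n m a : (forall i, (i < n)%N -> a i = 0) -> 'X^n %| trunc m a.
Proof. by move=> a0; apply/dvdXnP => i /a0 ai; rewrite coef_poly ai if_same. Qed.

(** Truncating [a] at stage n costs nothing, as the nth iterate is only used
    modulo the nth power of the variable. *)
Fixpoint tube_iter a beta n : {poly R} :=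
  if n is n'.+1 then trunc n a \Po ('X + beta *: tube_iter a beta n') else 0.

Definition tube_coef a beta n : R := (tube_iter a beta n.+1)`_n.

Section Formal.
Variables (a : nat -> R) (beta : R).
Hypotheses (a0 : a 0%N = 0) (a1 : a 1%N = 0).
Let q := tube_iter a beta.
Let b := tube_coef a beta.

Let a01 i : (i < 2)%N -> a i = 0. Proof. by case: i => [|[|]]. Qed.

Lemma dvdX_arg p : 'X^2 %| p -> 'X %| 'X + beta *: p.
Proof.
move=> Xp; rewrite dvdp_add // -mul_polyC dvdp_mull //.
by apply: dvdp_trans Xp; rewrite expr2 dvdp_mulIl.
Qed.

Lemma dvdX_tube_iter n : 'X^2 %| q n.
Proof.
elim: n => [|n IH] /=; first exact: dvdp0.
by apply: dvdXn_comp; [exact: dvdX_arg|exact: dvdXn_trunc0].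
Qed.

Lemma arg_sub p c : ('X + beta *: p) - ('X + beta *: c) = beta%:P * (p - c).
Proof. by rewrite -!mul_polyC; ring. Qed.

Lemma dvdXn_tube_iter n : 'X^n %| q n.+1 - q n.
Proof.
elim: n => [|n IH]; first by rewrite expr0 dvd1p.
rewrite /q /= -/(q n.+1) -/(q n); set T := trunc n.+1 a; set T' := trunc n.+2 a.
set c := 'X + beta *: q n.+1; set e := 'X + beta *: q n.
have -> : (T' \Po c) - (T \Po e) = ((T' - T) \Po c) + ((T \Po c) - (T \Po e)).
  by rewrite comp_polyB; ring.
have Xc : 'X %| c by exact/dvdX_arg/dvdX_tube_iter.
apply: dvdp_add; first by apply: dvdXn_comp => //; exact: dvdXn_trunc.
apply: dvdXn_comp_contract => //; first exact: dvdXn_trunc0.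
  exact/dvdX_arg/dvdX_tube_iter.
by rewrite arg_sub dvdp_mull.
Qed.

Lemma coef_tube_iter n i : (i < n)%N -> (q n)`_i = b i.
Proof.
move=> /subnKC <-; elim: (n - i.+1)%N => [|m IH]; first by rewrite addn0.
rewrite -IH addnS; apply/eqP; rewrite -subr_eq0 -coefB; apply/eqP.
by move/dvdXnP: (dvdXn_tube_iter (i.+1 + m)); apply; rewrite addSn ltnS leq_addr.
Qed.

Lemma dvdXn_tube_iter_trunc n : 'X^n %| q n - trunc n b.
Proof.
by apply/dvdXnP => i lt_in; rewrite coefB coef_poly lt_in coef_tube_iter ?subrr.
Qed.

Lemma dvdX_trunc_tube n : 'X^2 %| trunc n b.
Proof.
apply: dvdXn_trunc0 => i lt_i2; rewrite -(@coef_tube_iter 2) //.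
by move/dvdXnP: (dvdX_tube_iter 2); apply.
Qed.

Lemma tube_coef_eq n :
  'X^n %| trunc n b - (trunc n a \Po ('X + beta *: trunc n b)).
Proof.
set B := trunc n b; set c := 'X + _; set e := 'X + beta *: q n.
have -> : B - (trunc n a \Po c) = (q n.+1 - q n) * (- 1) + (B - q n)
  + ((trunc n.+1 a - trunc n a) \Po e) + ((trunc n a \Po e) - (trunc n a \Po c)).
  by rewrite comp_polyB /q /= -/(q n) -/e; ring.
have qB : 'X^n %| B - q n by rewrite -dvdpNr opprB dvdXn_tube_iter_trunc.
apply: dvdp_add; [apply: dvdp_add; [apply: dvdp_add => //|]|].
- by rewrite dvdp_mulr ?dvdXn_tube_iter.
- by apply: dvdXn_comp; [exact/dvdX_arg/dvdX_tube_iter|rewrite dvdXn_trunc].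
apply: dvdp_trans (dvdp_comp_sub _ _ _).
by rewrite arg_sub dvdp_mull // dvdXn_tube_iter_trunc.
Qed.

(** Put c(t) = t + beta b(t) and phi(x) = x - beta a(x).  The implicit equation
    says phi o c = id.  Then (c o phi) o c = c, hence c o phi = id because
    composition with c is injective, and b o phi = a o c o phi = a. *)
Lemma tube_coef_comp n :
  'X^n %| (trunc n b \Po ('X - beta *: trunc n a)) - trunc n a.
Proof.
set B := trunc n b; set A := trunc n a; set phi := 'X - beta *: A.
set c := 'X + beta *: B.
have XA : 'X^2 %| A by exact: dvdXn_trunc0.
have XB : 'X^2 %| B := dvdX_trunc_tube n.
have BA : 'X^n %| B - (A \Po c) := tube_coef_eq n.
have phi_c : (phi \Po c) - 'X = beta%:P * (B - (A \Po c)).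
  by rewrite comp_polyB comp_polyX comp_polyZ /c -!mul_polyC; ring.
have Xphi : 'X %| phi.
  rewrite /phi -scaleNr -mul_polyC dvdp_add ?dvdp_mull //.
  by apply: dvdp_trans XA; rewrite expr2 dvdp_mulIl.
have c_phi : 'X^n %| (c \Po phi) - 'X.
  have /dvdpP[d Bd] := XB.
  have cE : c = 'X * (1 + beta *: (d * 'X)) by rewrite /c Bd -!mul_polyC; ring.
  apply: (@dvdXn_comp_inj _ _ _ (1 + beta *: (d * 'X))).
    by rewrite coefD coefZ coefMX coef1 /= mulr0 addr0 oner_neq0.
  rewrite -cE comp_polyB -comp_polyA comp_polyX -[X in _ - X](comp_polyXr c).
  apply: dvdp_trans (dvdp_comp_sub _ _ _).
  by rewrite phi_c dvdp_mull.
have -> : (B \Po phi) - A = ((B - (A \Po c)) \Po phi) + ((A \Po (c \Po phi)) - (A \Po 'X)).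
  by rewrite comp_polyXr comp_polyB comp_polyA; ring.
apply: dvdp_add; first exact: dvdXn_comp.
exact: dvdp_trans (dvdp_comp_sub _ _ _).
Qed.

Lemma expr1D_quad (y : {poly R}) k : exists s, (1 + y) ^+ k = 1 + y *+ k + y ^+ 2 * s.
Proof.
elim: k => [|k [s IH]]; first by exists 0; rewrite expr0; ring.
by exists (k%:R + s + y * s); rewrite exprS IH; ring.
Qed.

Section Order.
Variable k : nat.
Hypotheses (k_gt1 : (1 < k)%N) (a_low : forall i, (i < k)%N -> a i = 0).

Lemma dvdXn_trunc_tube n : (k <= n)%N -> 'X^k %| trunc n b.
Proof.
move=> kn; rewrite -[trunc n b](subrK (trunc n a \Po ('X + beta *: trunc n b))).
apply: dvdp_add; first exact: dvdp_trans (dvdp_exp2l _ kn) (tube_coef_eq n).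
by apply: dvdXn_comp; [exact/dvdX_arg/dvdX_trunc_tube|exact: dvdXn_trunc0].
Qed.

(** Write b = t^k e, a = t^k r.  Then c = t + beta b = t (1 + beta t^(k-1) e), so
    modulo t^(2k) one has
    a(c) - a = t^k ((1 + beta t^(k-1) e)^k - 1) r = k beta t^(2k-1) e(0) r(0). *)
Lemma tube_coef_variation :
  'X^(2 * k) %| trunc (2 * k) b - trunc (2 * k) a - (k%:R * beta * a k * b k) *: 'X^(2 * k - 1).
Proof.
set B := trunc _ b; set A := trunc _ a; set c := 'X + beta *: B.
have k_le : (k <= 2 * k)%N by lia.
have /dvdpP[e Be] : 'X^k %| B by exact: dvdXn_trunc_tube.
have /dvdpP[r Ar] : 'X^k %| A by exact: dvdXn_trunc0.
have e0 : e.[0] = b k.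
  have : B`_k = b k by rewrite coef_poly; case: ifP => //; lia.
  by rewrite Be coefMXn ltnn subnn horner_coef0.
have r0 : r.[0] = a k.
  have : A`_k = a k by rewrite coef_poly; case: ifP => //; lia.
  by rewrite Ar coefMXn ltnn subnn horner_coef0.
have BA : 'X^(2 * k) %| B - (A \Po c) by exact: tube_coef_eq.
have [s sE] := expr1D_quad (beta *: (e * 'X^(k - 1))) k.
have cE : c = 'X * (1 + beta *: (e * 'X^(k - 1))).
  by rewrite /c Be -{1}(subnK (ltnW k_gt1)) exprD expr1 -!mul_polyC; ring.
have X2k : 'X^(2 * k) = 'X^k * 'X^k :> {poly R} by rewrite -exprD addnn mul2n.
have X2k1 : 'X^(2 * k - 1) = 'X^k * 'X^(k - 1) :> {poly R}.
  by rewrite -exprD; congr (_ ^+ _); lia.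
have Xk : 'X^k = 'X * 'X^(k - 1) :> {poly R}.
  by rewrite -exprS; congr (_ ^+ _); lia.
have -> : B - A - (k%:R * beta * a k * b k) *: 'X^(2 * k - 1) =
   (B - (A \Po c)) + 'X^k * ((r \Po c) - (r \Po 'X))
  + 'X^k * 'X^(k - 1) * ((k%:R * beta)%:P * (e * (r \Po c) - (a k * b k)%:P))
  + 'X^k * ('X^(k - 1) * 'X^(k - 1)) * (beta%:P ^+ 2 * e ^+ 2 * s * (r \Po c)).
  rewrite Ar comp_polyM comp_Xn_poly cE exprMn sE -cE comp_polyXr X2k1 -!mul_polyC.
  by rewrite !polyCM polyC_natr; ring.
apply: dvdp_add; [apply: dvdp_add; [apply: dvdp_add => //|]|].
- rewrite X2k dvdp_mul //; apply: dvdp_trans (dvdp_comp_sub _ _ _).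
  by rewrite /c addrAC subrr add0r Be -mul_polyC !dvdp_mull.
- have -> : 'X^(2 * k) = 'X^k * 'X^(k - 1) * 'X :> {poly R}.
    by rewrite X2k {2}Xk; ring.
  rewrite dvdp_mul // dvdp_mull //.
  rewrite -['X]subr0 -polyC0 dvdp_XsubCl rootE !hornerE horner_comp cE.
  by rewrite hornerM hornerX mul0r e0 r0; apply/eqP; ring.
- apply: dvdp_mulr; rewrite X2k dvdp_mul // -exprD; apply: dvdp_exp2l; lia.
Qed.

Lemma tube_coef_lt i : (i < 2 * k - 1)%N -> b i = a i.
Proof.
move=> lt_i; move/dvdXnP: tube_coef_variation => /(_ i).
rewrite !coefB coefZ coefXn !coef_poly.
have -> : (i < 2 * k)%N by lia.
by rewrite ltn_eqF // mulr0 subr0 => /(_ isT)/eqP; rewrite subr_eq0 => /eqP.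
Qed.

Lemma tube_coef_2k1 : b (2 * k - 1)%N = a (2 * k - 1)%N + k%:R * beta * a k ^+ 2.
Proof.
move/dvdXnP: tube_coef_variation => /(_ (2 * k - 1)%N).
rewrite !coefB coefZ coefXn !coef_poly eqxx mulr1.
have -> : (2 * k - 1 < 2 * k)%N by lia.
rewrite (@tube_coef_lt k) ?expr2 => [/(_ isT)/eqP|]; last by lia.
by rewrite subr_eq0 subr_eq => /eqP ->; ring.
Qed.
End Order.

End Formal.

(** Majorants are compatible with sums, products and composition, hence with the
    iteration; the bound need only be proved for nonnegative coefficients. *)
Definition coef_dominated p q := forall i, `|p`_i| <= q`_i.

Lemma coef_dominatedD p q c e :
  coef_dominated p q -> coef_dominated c e -> coef_dominated (p + c) (q + e).
Proof. by move=> pq ce i; rewrite !coefD (le_trans (ler_normD _ _)) ?lerD. Qed.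

Lemma coef_dominatedM p q c e :
  coef_dominated p q -> coef_dominated c e -> coef_dominated (p * c) (q * e).
Proof.
move=> pq ce i; rewrite !coefM (le_trans (ler_norm_sum _ _ _)) // ler_sum // => j _.
by rewrite normrM ler_pM.
Qed.

Lemma coef_dominatedC (x y : R) : `|x| <= y -> coef_dominated x%:P y%:P.
Proof. by move=> xy i; rewrite !coefC; case: eqP; rewrite ?normr0. Qed.

Lemma coef_dominatedX : coef_dominated 'X 'X.
Proof. by move=> i; rewrite coefX normr_nat. Qed.

Lemma coef_dominated_comp p q c e :
  coef_dominated p q -> coef_dominated c e -> coef_dominated (p \Po c) (q \Po e).
Proof.
move=> pq ce; set n := maxn (size p) (size q).
have compE (d h : {poly R}) : (size d <= n)%N ->
    d \Po h = \sum_(i < n) (d`_i)%:P * h ^+ i.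
  move=> dn; rewrite /comp_poly (@horner_coef_wide _ n) ?size_map_polyC //.
  by apply: eq_bigr => i _; rewrite coef_map.
rewrite !compE ?leq_maxl ?leq_maxr //; elim/big_ind2: _ => [||i _].
- by move=> i; rewrite coef0 normr0.
- by move=> *; exact: coef_dominatedD.
apply: coef_dominatedM; first exact: coef_dominatedC.
elim: (i : nat) => [|m IH]; first by apply: coef_dominatedC; rewrite normr1.
by rewrite !exprS; exact: coef_dominatedM.
Qed.

Lemma coef_dominated_tube_iter a beta n :
  coef_dominated (tube_iter a beta n) (tube_iter (fun i => `|a i|) `|beta| n).
Proof.
elim: n => [|n IH] /=; first by move=> i; rewrite coef0 normr0.
apply: coef_dominated_comp.
  by move=> i; rewrite !coef_poly; case: ifP; rewrite ?normr0.
apply: coef_dominatedD; first exact: coef_dominatedX.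
by rewrite -!mul_polyC; apply: coef_dominatedM => //; exact: coef_dominatedC.
Qed.

Lemma sum_expr_le2 (t : R) n : 0 <= t -> 2 * t <= 1 -> \sum_(i < n) t ^+ i <= 2.
Proof.
move=> t0 t1; elim: n => [|n IH]; first by rewrite big_ord0.
rewrite big_ord_recl expr0; under eq_bigr do rewrite exprS.
rewrite -mulr_sumr; nra.
Qed.

(** If the majorant iterate is at most r at r, the next one is at most
    |a|((1 + |beta|) r), which is O(r^2) and so at most r for small r. *)
Lemma tube_coef_bound a beta (C M : R) : 0 <= C -> 0 <= M ->
  a 0%N = 0 -> a 1%N = 0 -> (forall n, `|a n| <= C * M ^+ n) ->
  exists2 r, 0 < r & forall n, `|tube_coef a beta n| * r ^+ n <= r.
Proof.
move=> C0 M0 a0 a1 aCM; set K := M * (1 + `|beta|).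
have K0 : 0 <= K by rewrite mulr_ge0 // addr_ge0.
(* 1 / d is small enough both for the geometric series of ratio K r and for
   2 C (K r)^2 <= r. *)
pose d := 2 * K + 2 * C * K ^+ 2 + 1; pose r := d^-1.
have CK0 : 0 <= C * K ^+ 2 by rewrite mulr_ge0 // exprn_ge0.
have d0 : 0 < d by rewrite /d; lra.
have r0 : 0 < r by rewrite invr_gt0.
have rd : r * d = 1 by rewrite mulVf // gt_eqF.
have Kr : 2 * (K * r) <= 1 by rewrite /d in rd; nra.
have CKr : 2 * C * K ^+ 2 * r <= 1 by rewrite /d in rd; nra.
pose Q := tube_iter (fun i => `|a i|) `|beta|.
have Q0 n i : 0 <= (Q n)`_i.
  exact: le_trans (normr_ge0 _) (coef_dominated_tube_iter a beta n i).
have Q0r n : 0 <= (Q n).[r].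
  by rewrite horner_coef sumr_ge0 // => i _; rewrite mulr_ge0 // exprn_ge0 // ltW.
have Qr n : (Q n).[r] <= r.
  elim: n => [|n IH]; first by rewrite horner0 ltW.
  rewrite /Q /= -/(Q n) horner_comp !hornerE; set x := r + _.
  have x0 : 0 <= x by rewrite addr_ge0 ?mulr_ge0 // ltW.
  have xr : x <= (1 + `|beta|) * r by rewrite mulrDl mul1r lerD // ler_wpM2l.
  have Mx : M * x <= K * r by rewrite /K -mulrA ler_wpM2l.
  have Mx0 : 0 <= M * x by rewrite mulr_ge0.
  rewrite horner_poly.
  have bound m : \sum_(i < m.+2) `|a i| * x ^+ i <= C * (K * r) ^+ 2 * 2.
    have -> : \sum_(i < m.+2) `|a i| * x ^+ i = \sum_(i < m) `|a i.+2| * x ^+ i.+2.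
      by rewrite 2!big_ord_recl /= a0 a1 normr0 !mul0r !add0r.
    apply: le_trans (_ : C * (K * r) ^+ 2 * \sum_(i < m) (K * r) ^+ i <= _).
      rewrite mulr_sumr ler_sum // => i _; rewrite -mulrA -exprD.
      apply: le_trans (_ : C * (M * x) ^+ i.+2 <= _).
        by rewrite exprMn (mulrA C); apply: ler_wpM2r; rewrite ?exprn_ge0 ?aCM.
      by rewrite ler_wpM2l // lerXn2r // nnegrE (le_trans Mx0).
    rewrite ler_wpM2l ?sum_expr_le2 ?mulr_ge0 ?exprn_ge0 //; lra.
  have: C * (K * r) ^+ 2 * 2 <= r.
    have -> : C * (K * r) ^+ 2 * 2 = (2 * C * K ^+ 2 * r) * r by ring.
    by rewrite ler_piMl // ltW.
  apply: le_trans; apply: le_trans (bound n).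
  by rewrite [leRHS]big_ord_recr /= lerDl mulr_ge0 // exprn_ge0.
exists r => // n; apply: le_trans (Qr n.+1).
apply: le_trans (_ : (Q n.+1)`_n * r ^+ n <= _).
  by rewrite ler_wpM2r ?exprn_ge0 ?(ltW r0) // coef_dominated_tube_iter.
case: (ltnP n (size (Q n.+1))) => [lt_n|ge_n].
  rewrite horner_coef (bigD1 (Ordinal lt_n)) //= lerDl sumr_ge0 // => i _.
  by rewrite mulr_ge0 // exprn_ge0 // ltW.
by rewrite nth_default // mul0r.
Qed.
End TubeSeries.

(** * Congruences of power series modulo weight *)

Section Weights.
Variables (T : comNzRingType) (k : nat).
Implicit Types (P Q X Y Z W : fps3 T) (s p q n : nat).

Definition wt j l m := (j + l + k * m)%N.

Definition ordw s P := forall j l m, (wt j l m < s)%N -> P j l m = 0.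

Definition eqw s P Q := forall j l m, (wt j l m < s)%N -> P j l m = Q j l m.

Lemma wt_split j l m p q r : (p <= j)%N -> (q <= l)%N -> (r <= m)%N ->
  (wt p q r + wt (j - p) (l - q) (m - r) = wt j l m)%N.
Proof.
move=> pj ql rm; rewrite /wt mulnBr.
have : (k * r <= k * m)%N by rewrite leq_mul2l rm orbT.
lia.
Qed.

Lemma ordwW s s' P : (s' <= s)%N -> ordw s P -> ordw s' P.
Proof. by move=> le_s P0 j l m lt_s; apply: P0; exact: leq_trans le_s. Qed.

Lemma ordw_add3 s P Q : ordw s P -> ordw s Q -> ordw s (add3 P Q).
Proof. by move=> P0 Q0 j l m lt_s; rewrite /add3 P0 // Q0 // addr0. Qed.

Lemma ordw_scale3 s c P : ordw s P -> ordw s (scale3 c P).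
Proof. by move=> P0 j l m lt_s; rewrite /scale3 P0 // mulr0. Qed.

Lemma ordw_mono3 s j l m : (s <= wt j l m)%N -> ordw s (mono3 T j l m).
Proof.
move=> le_s j' l' m' lt_s; rewrite /mono3; case: and3P => // -[/eqP ej /eqP el /eqP em].
by move: lt_s; rewrite ej el em ltnNge le_s.
Qed.

Lemma ordw_mul3 p q P Q : ordw p P -> ordw q Q -> ordw (p + q) (mul3 P Q).
Proof.
move=> P0 Q0 j l m lt_s; rewrite /mul3; apply: big1 => a _; apply: big1 => b _; apply: big1 => c _.
have := wt_split (leq_ord a) (leq_ord b) (leq_ord c).
case: (ltnP (wt a b c) p) => [/P0 -> _|le_p]; first by rewrite mul0r.
by move=> e; rewrite Q0 ?mulr0 //; lia.
Qed.

(** In a product of weight below p + q + s, a first factor of weight at least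
    p + s meets a second factor of weight below q, which is zero, and
    conversely. *)
Lemma eqw_mul3 p q s P P' Q Q' :
    ordw p P -> ordw p P' -> ordw q Q -> ordw q Q' ->
    eqw (p + s) P P' -> eqw (q + s) Q Q' ->
  eqw (p + q + s) (mul3 P Q) (mul3 P' Q').
Proof.
move=> P0 P0' Q0 Q0' PP QQ j l m lt_s; rewrite /mul3.
apply: eq_bigr => a _; apply: eq_bigr => b _; apply: eq_bigr => c _.
have := wt_split (leq_ord a) (leq_ord b) (leq_ord c).
case: (ltnP (wt a b c) p) => [lt_p _|le_p]; first by rewrite P0 // P0' // !mul0r.
case: (ltnP (wt (j - a) (l - b) (m - c)) q) => [lt_q _|le_q].
  by rewrite Q0 // Q0' // !mulr0.
by move=> e; rewrite PP ?QQ //; lia.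
Qed.

Definition sub3 P Q : fps3 T := fun j l m => P j l m - Q j l m.

(** Leibniz rule at the first weight where the products may differ: there only
    the leading parts of the unchanged factors contribute. *)
Lemma mul3_variation p q s P P' P0 Q Q' Q0 j l m :
    ordw p P -> ordw p P' -> ordw q Q -> ordw q Q' ->
    eqw (p + s) P P' -> eqw (q + s) Q Q' ->
    eqw p.+1 P P0 -> eqw q.+1 Q' Q0 -> wt j l m = (p + q + s)%N ->
  mul3 P Q j l m - mul3 P' Q' j l m =
  mul3 P0 (sub3 Q Q') j l m + mul3 (sub3 P P') Q0 j l m.
Proof.
move=> oP oP' oQ oQ' PP QQ PP0 QQ0 wE; rewrite /mul3 -sumrB -big_split /=.
apply: eq_bigr => a _; rewrite -sumrB -big_split /=.
apply: eq_bigr => b _; rewrite -sumrB -big_split /=.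
apply: eq_bigr => c _.
have := wt_split (leq_ord a) (leq_ord b) (leq_ord c).
rewrite /sub3; set j' := (j - a)%N; set l' := (l - b)%N; set m' := (m - c)%N => e.
have -> : P0 a b c * (Q j' l' m' - Q' j' l' m') =
    P a b c * (Q j' l' m' - Q' j' l' m').
  case: (ltnP (wt a b c) p.+1) => [/PP0 -> //|le_p].
  by rewrite QQ ?subrr ?mulr0 //; lia.
have -> : (P a b c - P' a b c) * Q0 j' l' m' = (P a b c - P' a b c) * Q' j' l' m'.
  case: (ltnP (wt j' l' m') q.+1) => [/QQ0 -> //|le_q].
  by rewrite PP ?subrr ?mul0r //; lia.
by ring.
Qed.

Lemma sum_delta n a (G : nat -> T) :
  \sum_(i < n.+1) (i == a :> nat)%:R * G i = if (a <= n)%N then G a else 0.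
Proof.
case: ifP => [a_le|/negbT a_gt]; last first.
  rewrite big1 // => i _; case: eqP => [ia|_]; last by rewrite mul0r.
  by move: a_gt; rewrite -ia -ltnS ltn_ord.
rewrite (bigD1 (Ordinal (a_le : a < n.+1)%N)) //= eqxx mul1r big1 ?addr0 // => i.
by rewrite -val_eqE /= => /negPf ->; rewrite mul0r.
Qed.

Lemma mono3E j l m j' l' m' :
  mono3 T j l m j' l' m' = (j' == j)%:R * ((l' == l)%:R * (m' == m)%:R).
Proof. by rewrite /mono3; do 3!case: eqP => _ //=; rewrite ?mul0r ?mulr0 ?mulr1. Qed.

Lemma mul3_mono3l a b c Q j l m : mul3 (mono3 T a b c) Q j l m =
  if [&& a <= j, b <= l & c <= m]%N then Q (j - a)%N (l - b)%N (m - c)%N else 0.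
Proof.
rewrite /mul3.
under eq_bigr => p _ do under eq_bigr => q _ do
  under eq_bigr => r _ do rewrite mono3E -!mulrA.
under eq_bigr => p _ do under eq_bigr => q _ do
  rewrite -!mulr_sumr (@sum_delta m c (fun r => Q (j - p)%N (l - q)%N (m - r)%N)).
under eq_bigr => p _ do
  rewrite -mulr_sumr (@sum_delta l b (fun q => if (c <= m)%N then Q (j - p)%N (l - q)%N (m - c)%N else 0)).
rewrite (@sum_delta j a (fun p => if (b <= l)%N then if (c <= m)%N then Q (j - p)%N (l - b)%N (m - c)%N else 0 else 0)).
by do 3!case: (_ <= _)%N.
Qed.

Lemma mul3C P Q : mul3 P Q = mul3 Q P.
Proof.
apply/funext => j; apply/funext => l; apply/funext => m; rewrite /mul3.
rewrite (reindex_inj rev_ord_inj); apply: eq_bigr => p _.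
rewrite (reindex_inj rev_ord_inj); apply: eq_bigr => q _.
rewrite (reindex_inj rev_ord_inj); apply: eq_bigr => r _ /=.
by rewrite !subSS !subKn ?leq_ord // mulrC.
Qed.

Lemma mul3_1 P : mul3 P (mono3 T 0 0 0) = P.
Proof.
rewrite mul3C; apply/funext => j; apply/funext => l; apply/funext => m.
by rewrite mul3_mono3l !subn0.
Qed.

Lemma mul3_mono3 a b c a' b' c' :
  mul3 (mono3 T a b c) (mono3 T a' b' c') = mono3 T (a + a') (b + b') (c + c').
Proof.
apply/funext => j; apply/funext => l; apply/funext => m.
rewrite mul3_mono3l /mono3; case: ifP => H; [congr (nat_of_bool _)%:R|]; last first.
  by case: and3P => // -[]; lia.
by apply/and3P/and3P => -[]; split; lia.
Qed.

Lemma exp3_mono3 a b c n : exp3 (mono3 T a b c) n = mono3 T (n * a) (n * b) (n * c).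
Proof. by elim: n => [|n IH] //=; rewrite IH mul3_mono3 !mulSn. Qed.

Lemma exp3S Z n : exp3 Z n.+1 = mul3 Z (exp3 Z n). Proof. by []. Qed.

Lemma ordw_exp3 z Z n : ordw z Z -> ordw (n * z) (exp3 Z n).
Proof.
move=> Z0; elim: n => [|n IH]; first by move=> j l m; rewrite ltn0.
by rewrite mulSn; exact: ordw_mul3.
Qed.

Lemma eqw_exp3 z s Z Z' n : ordw z Z -> ordw z Z' -> eqw (z + s) Z Z' ->
  eqw (n * z + s) (exp3 Z n) (exp3 Z' n).
Proof.
move=> Z0 Z0' ZZ; elim: n => [//|n IH].
by rewrite mulSn; apply: eqw_mul3 => //; exact: ordw_exp3.
Qed.

(** To leading order X^(n+1) - X'^(n+1) is (n+1) x^n (X - X'). *)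
Lemma exp3_variation s X X' n j l m :
    ordw 1 X -> ordw 1 X' -> eqw 2 X (mono3 T 1 0 0) -> eqw 2 X' (mono3 T 1 0 0) ->
    eqw (1 + s) X X' -> wt j l m = (n.+1 + s)%N ->
  exp3 X n.+1 j l m - exp3 X' n.+1 j l m =
  if (n <= j)%N then n.+1%:R * (X (j - n)%N l m - X' (j - n)%N l m) else 0.
Proof.
move=> X0 X0' Xx Xx' XX; elim: n j l m => [|n IH] j l m wE.
  by rewrite /exp3 /= !mul3_1 subn0 mul1r.
rewrite !(exp3S _ n.+1) (@mul3_variation 1 n.+1 s _ _ (mono3 T 1 0 0) _ _ (mono3 T n.+1 0 0)) //.
- rewrite [mul3 (sub3 _ _) _]mul3C !mul3_mono3l /= !andbT !subn0.
  case: j wE => [|j] wE; first by rewrite ltn0 addr0.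
  rewrite /sub3 !ltnS subn1 /= subSS IH; last by move: wE; rewrite /wt; lia.
  by case: ifP => _; rewrite ?addr0 // -[n.+2]addn1 natrD; ring.
- by have := @ordw_exp3 1 _ n.+1 X0; rewrite muln1.
- by have := @ordw_exp3 1 _ n.+1 X0'; rewrite muln1.
- by have := @eqw_exp3 1 s X X' n.+1 X0 X0' XX; rewrite muln1.
have := @eqw_exp3 1 1 X' (mono3 T 1 0 0) n.+1 X0' _ Xx'.
rewrite exp3_mono3 !muln1 !muln0 addn1; apply.
by apply: ordw_mono3; rewrite /wt; lia.
Qed.

End Weights.

(** * Substitution into the model hypersurface v = x^k *)

Section LinearPart.
Variables (T : comNzRingType) (t : T) (k : nat).
Hypothesis k_gt0 : (0 < k)%N.
Implicit Types (j l m n a b : nat).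

(** With t = i these are z and w restricted to v = x^k. *)
Definition lin_z : fps3 T := add3 (mono3 T 1 0 0) (scale3 t (mono3 T 0 1 0)).
Definition lin_w : fps3 T := add3 (mono3 T 0 0 1) (scale3 t (mono3 T k 0 0)).

Lemma mul3_binomial (M N P : fps3 T) j l m :
  mul3 (add3 M (scale3 t N)) P j l m = mul3 M P j l m + t * mul3 N P j l m.
Proof.
rewrite /mul3 mulr_sumr -big_split; apply: eq_bigr => a _ /=.
rewrite mulr_sumr -big_split; apply: eq_bigr => b _ /=.
rewrite mulr_sumr -big_split; apply: eq_bigr => c _ /=.
by rewrite /add3 /scale3; ring.
Qed.

Lemma exp3_lin_z n j l m : exp3 lin_z n j l m =
  if (j + l == n)%N && (m == 0)%N then 'C(n, l)%:R * t ^+ l else 0.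
Proof.
elim: n j l m => [|n IH] j l m.
  by rewrite /exp3 /= /mono3 addn_eq0; case: j l m => [|j] [|l] [|m]; rewrite //= ?bin0 ?mulr1.
rewrite exp3S mul3_binomial !mul3_mono3l !IH !subn0.
case: m => [|m]; rewrite ?andbF ?if_same ?mulr0 ?addr0 // !andbT.
case: j l => [|j] [|l]; rewrite ?addn0 ?add0n ?subn1 ?mulr0 ?addr0 ?add0r //=.
- rewrite eqSS; case: eqP => [->|]; rewrite ?mulr0 //.
  by rewrite !binn exprS; ring.
- by rewrite eqSS !bin0.
- rewrite !addSn !addnS eqSS; case: eqP => _; rewrite ?mulr0 ?addr0 //.
  by rewrite binS exprS natrD; ring.
Qed.

Lemma exp3_lin_w n j l m : exp3 lin_w n j l m =
  if [&& l == 0, m <= n & j == k * (n - m)]%N then 'C(n, m)%:R * t ^+ (n - m) else 0.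
Proof.
elim: n j l m => [|n IH] j l m.
  rewrite /exp3 /= /mono3 sub0n muln0 leqn0.
  by case: j l m => [|j] [|l] [|m]; rewrite //= ?bin0 ?mulr1.
rewrite exp3S mul3_binomial !mul3_mono3l !IH !subn0 /=.
case: l => [|l]; rewrite ?andbF ?if_same ?mulr0 ?addr0 //= andbT.
case: m => [|m].
  rewrite !subn0 /= add0r !bin0.
  have -> : (j == k * n.+1)%N = (k <= j)%N && (j - k == k * n)%N.
    by rewrite mulnS; apply/eqP/andP => [->|[kj /eqP]]; [rewrite leq_addr addKn|lia].
  by case: (k <= j)%N; case: eqP => _; rewrite ?mulr0 // exprS; ring.
rewrite /= !subSS !subn0 ltnS.
case: (ltngtP m n) => [lt_mn|gt_mn|->]; rewrite ?mulr0 ?addr0 /=.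
- have -> : (j == k * (n - m))%N = (k <= j)%N && (j - k == k * (n - m.+1))%N.
    rewrite -(subnSK lt_mn) mulnS.
    by apply/eqP/andP => [->|[kj /eqP]]; [rewrite leq_addr addKn|lia].
  case: (k <= j)%N; case: eqP => _; rewrite ?mulr0 ?addr0 //.
  by rewrite -(subnSK lt_mn) binS exprS natrD /=; ring.
- by rewrite if_same mulr0 ?addr0.
- by rewrite if_same mulr0 addr0 !binn.
Qed.

(** (x + t y)^a (u + t x^k)^b, expanded by the binomial theorem: the exponents of
    y and u determine that of x. *)
Lemma mul3_lin j l m a b : mul3 (exp3 lin_z a) (exp3 lin_w b) j l m =
  if [&& l <= a, m <= b & j == a - l + k * (b - m)]%N then
    'C(a, l)%:R * 'C(b, m)%:R * t ^+ (l + (b - m)) else 0.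
Proof.
pose zc p q : T := if (p + q == a)%N then 'C(a, q)%:R * t ^+ q else 0.
pose wc p r : T :=
  if (r <= b)%N && (p == k * (b - r))%N then 'C(b, r)%:R * t ^+ (b - r) else 0.
have zcE p q r : exp3 lin_z a p q r = (r == 0%N)%:R * zc p q.
  by rewrite exp3_lin_z /zc; case: eqP => _; case: eqP => _; rewrite ?mul1r ?mul0r.
have wcE p q r : exp3 lin_w b p q r = (q == 0%N)%:R * wc p r.
  by rewrite exp3_lin_w /wc; case: eqP => _ /=; rewrite ?mul1r ?mul0r.
have -> : mul3 (exp3 lin_z a) (exp3 lin_w b) j l m = \sum_(p < j.+1) zc p l * wc (j - p)%N m.
  apply: eq_bigr => p _.
  transitivity (\sum_(q < l.+1) (q == l :> nat)%:R * (zc p q * wc (j - p)%N m)); last first.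
    by rewrite (sum_delta l l (fun q => zc p q * wc (j - p)%N m)) leqnn.
  apply: eq_bigr => q _.
  transitivity (\sum_(r < m.+1) (r == 0 :> nat)%:R *
      ((q == l :> nat)%:R * (zc p q * wc (j - p)%N (m - r)%N))); last first.
    by rewrite (sum_delta m 0 (fun r => (q == l :> nat)%:R * (zc p q * wc (j - p)%N (m - r)%N))) subn0.
  apply: eq_bigr => r _; rewrite zcE wcE.
  have -> : (l - q == 0)%N = (q == l :> nat) by rewrite subn_eq0 eqn_leq leq_ord.
  by ring.
case: (leqP l a) => [la|al] /=; last first.
  apply: big1 => p _; rewrite /zc; case: eqP => [e|_]; last by rewrite mul0r.
  by move: al; rewrite -e ltnNge leq_addl.
transitivity (\sum_(p < j.+1) (p == (a - l)%N :> nat)%:R *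
    ('C(a, l)%:R * t ^+ l * wc (j - p)%N m)).
  apply: eq_bigr => p _; rewrite /zc.
  have -> : (p + l == a)%N = (p == (a - l)%N :> nat) by apply/eqP/eqP; lia.
  by case: eqP => _; rewrite ?mul1r ?mul0r.
rewrite (sum_delta j (a - l)%N (fun p => 'C(a, l)%:R * t ^+ l * wc (j - p)%N m)) /wc.
case: (m <= b)%N; rewrite /= ?mulr0 ?if_same //.
have -> : (j == a - l + k * (b - m))%N = (a - l <= j)%N && (j - (a - l) == k * (b - m))%N.
  by apply/eqP/andP => [->|[le /eqP]]; [rewrite leq_addr addKn|lia].
case: (a - l <= j)%N => //=; case: eqP => _; rewrite ?mulr0 //.
by rewrite exprD; ring.
Qed.

Definition lin_subst (h : fps2 T) : fps3 T := fun j l m =>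
  \sum_(a < (j + l + m).+1) \sum_(b < (j + l + m).+1)
    h a b * mul3 (exp3 lin_z a) (exp3 lin_w b) j l m.

(** The x-exponent of a term of z^a w^b is p + k i with p coming from z and i the
    number of factors t x^k of w; for j < k only i = 0 is possible, for
    k <= j < 2k only i = 0 and i = 1. *)
Lemma lin_subst_low (h : fps2 T) j l m : (j < k)%N ->
  lin_subst h j l m = h (j + l)%N m * 'C(j + l, l)%:R * t ^+ l.
Proof.
move=> lt_jk; rewrite /lin_subst pair_bigA /=.
have a_lt : (j + l < (j + l + m).+1)%N by lia.
have b_lt : (m < (j + l + m).+1)%N by lia.
rewrite (bigD1 (Ordinal a_lt, Ordinal b_lt)) //= big1 ?addr0 => [|[a b]].
  rewrite mul3_lin leq_addl leqnn subnn muln0 addnK !addn0 eqxx /= binn; ring.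
rewrite xpair_eqE -!val_eqE /= mul3_lin => neq.
case: and3P => [[la mb /eqP jE]|_]; last by rewrite mulr0.
have bm : (b - m = 0)%N.
  by apply/eqP; rewrite -leqn0 -ltnS -(ltn_pmul2l k_gt0) muln1; lia.
rewrite bm muln0 addn0 in jE.
by case/negP: neq; apply/andP; split; apply/eqP; lia.
Qed.

Lemma lin_subst_mid (h : fps2 T) j l m : (k <= j < 2 * k)%N ->
  lin_subst h j l m = h (j + l)%N m * 'C(j + l, l)%:R * t ^+ l +
    h (j - k + l)%N m.+1 * 'C(j - k + l, l)%:R * m.+1%:R * t ^+ l.+1.
Proof.
move=> /andP[le_kj lt_jk]; rewrite /lin_subst pair_bigA /=.
have a_lt : (j + l < (j + l + m).+1)%N by lia.
have b_lt : (m < (j + l + m).+1)%N by lia.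
have a_lt' : (j - k + l < (j + l + m).+1)%N by lia.
have b_lt' : (m.+1 < (j + l + m).+1)%N by lia.
rewrite (bigD1 (Ordinal a_lt, Ordinal b_lt)) //=.
rewrite (bigD1 (Ordinal a_lt', Ordinal b_lt')) /=; last first.
  by rewrite xpair_eqE -!val_eqE /= (gtn_eqF (ltnSn m)) andbF.
rewrite big1 ?addr0 => [|[a b]].
  rewrite -exp3S !mul3_lin !leq_addl leqnn leqnSn subnn subSnn muln0 muln1 !addnK !addn0 addn1.
  by rewrite subnK // !eqxx /= binn binSn; ring.
rewrite !xpair_eqE -!val_eqE /= mul3_lin => neq.
case: and3P => [[la mb /eqP jE]|_]; last by rewrite mulr0.
have : (b - m < 2)%N by rewrite -(ltn_pmul2l k_gt0); lia.
case/andP: neq => /negP neq1 /negP neq2.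
case bm: (b - m)%N jE => [|[|//]] jE _; [case: neq1|case: neq2].
  by apply/andP; split; apply/eqP; lia.
by apply/andP; split; apply/eqP; lia.
Qed.

Lemma lin_subst_eq0 (h : fps2 T) n j l m :
    (forall a b, (a + k * b = n)%N -> h a b = 0) -> wt k j l m = n ->
  lin_subst h j l m = 0.
Proof.
move=> h0 wE; apply: big1 => a _; apply: big1 => b _; rewrite mul3_lin.
case: and3P => [[la mb /eqP jE]|_]; last by rewrite mulr0.
have kmb : (k * m <= k * b)%N by rewrite leq_mul2l mb orbT.
by rewrite h0 ?mul0r // -wE /wt; rewrite mulnBr in jE; lia.
Qed.

End LinearPart.

(** * The kernel of the linearized problem *)

Section Kernel.
Variable R : realType.
Local Notation ii := (0 +i* 1 : R[i]).

Lemma ImD (x y : R[i]) : complex.Im (x + y) = complex.Im x + complex.Im y.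
Proof. by case: x y => [? ?] [? ?]. Qed.
Lemma ReD (x y : R[i]) : complex.Re (x + y) = complex.Re x + complex.Re y.
Proof. by case: x y => [? ?] [? ?]. Qed.
Lemma ReB (x y : R[i]) : complex.Re (x - y) = complex.Re x - complex.Re y.
Proof. by case: x y => [? ?] [? ?]. Qed.
Lemma ImB (x y : R[i]) : complex.Im (x - y) = complex.Im x - complex.Im y.
Proof. by case: x y => [? ?] [? ?]. Qed.
Lemma Re_natM (x : R[i]) n : complex.Re (x * n%:R) = complex.Re x * n%:R.
Proof. by rewrite !mulr_natr; elim: n => [|n IH] //; rewrite !mulrS ReD IH. Qed.
Lemma Im_natM (x : R[i]) n : complex.Im (x * n%:R) = complex.Im x * n%:R.
Proof. by rewrite !mulr_natr; elim: n => [|n IH] //; rewrite !mulrS ImD IH. Qed.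
Lemma Re_mulii (x : R[i]) : complex.Re (x * ii) = - complex.Im x.
Proof. by case: x => u v /=; ring. Qed.
Lemma Im_mulii (x : R[i]) : complex.Im (x * ii) = complex.Re x.
Proof. by case: x => u v /=; ring. Qed.

Lemma ii_neq0 : ii != 0.
Proof. by rewrite eq_complex /= oner_eq0 andbF. Qed.

Lemma mul_iiX_eq0 (x : R[i]) n :
  complex.Re (x * ii ^+ n) = 0 -> complex.Im (x * ii ^+ n) = 0 -> x = 0.
Proof.
move=> re0 im0; have /eqP : x * ii ^+ n = 0.
  by apply/eqP; rewrite eq_complex re0 im0 eqxx.
by rewrite mulf_eq0 expf_eq0 (negPf ii_neq0) andbF orbF => /eqP.
Qed.

Lemma Re_iiX_eq0 (x : R[i]) n :
  complex.Re (x * ii ^+ n) = 0 -> complex.Re (x * ii ^+ n.+1) = 0 -> x = 0.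
Proof.
move=> re0; rewrite exprSr mulrA Re_mulii => /eqP; rewrite oppr_eq0 => /eqP.
exact: mul_iiX_eq0.
Qed.

Lemma Im_iiX_eq0 (x : R[i]) n :
  complex.Im (x * ii ^+ n) = 0 -> complex.Im (x * ii ^+ n.+1) = 0 -> x = 0.
Proof. by move=> im0; rewrite exprSr mulrA Im_mulii => re0; exact: mul_iiX_eq0 im0. Qed.

Variables (k s : nat).
Hypotheses (k_gt2 : (2 < k)%N) (s_gt0 : (0 < s)%N).

(** Here [f], [g], [A] stand for the differences df, dg, dA of the introduction.
    Multiplication by i exchanges real and imaginary parts, so that each
    coefficient is killed by two conditions on consecutive powers of i. *)
Lemma model_kernel (f g : fps2 R[i]) (A : fps3 R) :
    (forall j m, [/\ A 0%N j m = 0, A 1%N j m = 0, A (k - 1)%N j m = 0 & A k j m = 0]) ->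
    (forall m, A (2 * k - 1)%N 0%N m = 0 /\ A (2 * k - 1)%N 1%N m = 0) ->
    (forall j l m, wt k j l m = (k + s)%N ->
      complex.Im (lin_subst ii k g j l m) =
        (if (k - 1 <= j)%N then k%:R * complex.Re (lin_subst ii k f (j - (k - 1))%N l m) else 0)
        + A j l m) ->
  [/\ forall a b, (a + k * b = k + s)%N -> g a b = 0,
      forall a b, (a + k * b = s.+1)%N -> f a b = 0
    & forall j l m, wt k j l m = (k + s)%N -> A j l m = 0].
Proof.
move=> A01 A2 eqA; have k_gt0 : (0 < k)%N by lia.
have kR : k%:R != 0 :> R by rewrite pnatr_eq0; lia.
(* x^0 and x^1: dg has no term in z, and its coefficients are real. *)
have Im0 a b : (a + k * b = k + s)%N -> complex.Im (g a b * ii ^+ a) = 0.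
  move=> wE; have := eqA 0%N a b; rewrite /wt add0n => /(_ wE).
  rewrite lin_subst_low // add0n binn mulr1 => ->.
  by have [-> _ _ _] := A01 a b; rewrite leqn0 ifN ?addr0 //; lia.
have g_pos a b : (a.+1 + k * b = k + s)%N -> g a.+1 b = 0.
  move=> wE; apply: (@Im_iiX_eq0 _ a); last exact: Im0.
  have := eqA 1%N a b; rewrite /wt add1n => /(_ wE).
  rewrite lin_subst_low ?add1n; [|lia..].
  rewrite binSn mulrAC Im_natM.
  have [_ -> _ _] := A01 a b; rewrite ifN ?addr0; last by lia.
  by move/eqP; rewrite mulf_eq0 pnatr_eq0 orbF => /eqP.
(* x^(k-1) and x^k: df has degree at most 1 in z, with the coefficient of z
   given by dg'. *)
have Re0 a b : (a + k * b = s.+1)%N -> complex.Re (f a b * ii ^+ a) = 0.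
  move=> wE; have /eqA : wt k (k - 1)%N a b = (k + s)%N by rewrite /wt; lia.
  have [_ _ -> _] := A01 a b; rewrite leqnn subnn addr0.
  rewrite !lin_subst_low ?add0n; [|lia..].
  have -> : (k - 1 + a = (k - 2 + a).+1)%N by lia.
  rewrite g_pos; last by lia.
  by rewrite !mul0r binn mulr1 => /esym/eqP; rewrite mulf_eq0 (negPf kR) => /eqP.
have ReIm a b : (a.+1 + k * b = s.+1)%N ->
    complex.Im (g a b.+1 * b.+1%:R * ii ^+ a.+1) =
    k%:R * (complex.Re (f a.+1 b * ii ^+ a) * a.+1%:R).
  move=> wE; have /eqA : wt k k a b = (k + s)%N by rewrite /wt; lia.
  have [_ _ _ ->] := A01 a b; rewrite ifT ?addr0; last by lia.
  rewrite lin_subst_mid; [|lia..].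
  have -> : (k + a = (k - 1 + a).+1)%N by lia.
  rewrite g_pos; last by lia.
  rewrite !mul0r add0r subnn add0n binn mulr1 => ->.
  have -> : (k - (k - 1) = 1)%N by lia.
  rewrite lin_subst_low; [|lia..].
  by rewrite add1n binSn mulrAC Re_natM.
have f_pos a b : (a.+2 + k * b = s.+1)%N -> f a.+2 b = 0.
  move=> wE; apply: (@Re_iiX_eq0 _ a.+1); last exact: Re0.
  have := ReIm a.+1 b wE; rewrite g_pos ?mulnS; last by lia.
  rewrite !mul0r => /esym/eqP.
  by rewrite !mulf_eq0 (negPf kR) pnatr_eq0 orbF => /eqP.
(* x^(2k-1) y^0 and x^(2k-1) y^1; the weight s.+1 >= 2 excludes the terms 1 and
   z, so a factor w is available. *)
have f0 a b : (a + k * b = s.+1)%N -> f a b = 0.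
  case: a b => [|[|a]] b wE; last exact: f_pos.
  - case: b wE => [|b]; rewrite ?muln0 // mulnS => wE.
    apply: (@Re_iiX_eq0 _ 0); first by apply: Re0; rewrite mulnS.
    have /eqA : wt k (2 * k - 1)%N 0%N b = (k + s)%N by rewrite /wt; lia.
    have [-> _] := A2 b; rewrite ifT ?addr0; last by lia.
    have -> : (2 * k - 1 - (k - 1) = k)%N by lia.
    rewrite !lin_subst_mid; [|lia..].
    have -> : (2 * k - 1 + 0 = (2 * k - 2).+1)%N by lia.
    have -> : (2 * k - 1 - k + 0 = (k - 2).+1)%N by lia.
    have -> : (k + 0 = (k - 2).+2)%N by lia.
    rewrite !g_pos ?f_pos ?mulnS; [|lia..].
    rewrite !mul0r subnn bin0 !add0r mulr1 mulrAC Re_natM => /esym/eqP.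
    by rewrite !mulf_eq0 (negPf kR) pnatr_eq0 orbF => /eqP.
  case: b wE => [|b]; rewrite ?muln0 ?mulnS => wE; first by lia.
  apply: (@Re_iiX_eq0 _ 1); first by apply: Re0; rewrite mulnS.
  have /eqA : wt k (2 * k - 1)%N 1%N b = (k + s)%N by rewrite /wt; lia.
  have [_ ->] := A2 b; rewrite ifT ?addr0; last by lia.
  have -> : (2 * k - 1 - (k - 1) = k)%N by lia.
  rewrite !lin_subst_mid; [|lia..].
  have -> : (2 * k - 1 + 1 = (2 * k - 1).+1)%N by lia.
  have -> : (2 * k - 1 - k + 1 = (k - 1).+1)%N by lia.
  have -> : (k + 1 = (k - 1).+2)%N by lia.
  rewrite !g_pos ?f_pos ?mulnS; [|lia..].
  rewrite !mul0r subnn add0n binn !add0r mulr1 mulrAC Re_natM => /esym/eqP.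
  by rewrite !mulf_eq0 (negPf kR) pnatr_eq0 orbF => /eqP.
(* Now dg' = 0 as well, and a constant dg has weight 0 < k + s. *)
have g0 a b : (a + k * b = k + s)%N -> g a b = 0.
  case: a => [|a] wE; last exact: g_pos.
  case: b wE => [|b] wE; first by lia.
  apply: (@Im_iiX_eq0 _ 0); first exact: Im0.
  have wE' : (1 + k * b = s.+1)%N by rewrite mulnS in wE; lia.
  have := ReIm 0%N b wE'; rewrite f0 // mul0r mul0r mulr0 mulrAC Im_natM => /eqP.
  by rewrite mulf_eq0 pnatr_eq0 orbF => /eqP.
split=> // j l m wE; have := eqA j l m wE.
rewrite (lin_subst_eq0 ii k_gt0 g0 wE); case: ifP => [le_j|_]; last by rewrite add0r.
rewrite (lin_subst_eq0 ii k_gt0 f0) ?mulr0 ?add0r // /wt.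
by move: wE; rewrite /wt; lia.
Qed.
End Kernel.

(** * Variation of the new coordinates *)

Section Substitution.
Variables (T : comNzRingType) (k : nat).
Implicit Types (A X Y U : fps3 T).

Definition ordw_coords X Y U := [/\ ordw k 1 X, ordw k 1 Y & ordw k k U].
Definition eqw_coords s X Y U X' Y' U' :=
  [/\ eqw k (1 + s) X X', eqw k (1 + s) Y Y' & eqw k (k + s) U U'].

Lemma eqw_monomial s X Y U X' Y' U' a b c :
    ordw_coords X Y U -> ordw_coords X' Y' U' -> eqw_coords s X Y U X' Y' U' ->
  eqw k (wt k a b c + s) (mul3 (exp3 X a) (mul3 (exp3 Y b) (exp3 U c)))
                       (mul3 (exp3 X' a) (mul3 (exp3 Y' b) (exp3 U' c))).
Proof.
move=> [oX oY oU] [oX' oY' oU'] [XX YY UU].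
have -> : wt k a b c = (a * 1 + (b * 1 + c * k))%N by rewrite /wt; lia.
by apply: eqw_mul3; [| |apply: ordw_mul3|apply: ordw_mul3| |apply: eqw_mul3];
  try exact: ordw_exp3; exact: eqw_exp3.
Qed.

Lemma eqw_monomial_lead X Y U a b c :
    ordw_coords X Y U ->
    eqw_coords 1 X Y U (mono3 T 1 0 0) (mono3 T 0 1 0) (mono3 T 0 0 1) ->
  eqw k (wt k a b c).+1 (mul3 (exp3 X a) (mul3 (exp3 Y b) (exp3 U c))) (mono3 T a b c).
Proof.
move=> oXYU eXYU.
have := @eqw_monomial 1 X Y U (mono3 T 1 0 0) (mono3 T 0 1 0) (mono3 T 0 0 1) a b c oXYU _ eXYU.
rewrite !exp3_mono3 !mul3_mono3 !muln0 !muln1 !addn0 !add0n addn1; apply.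
by split; apply: ordw_mono3; rewrite /wt ?muln1.
Qed.

Lemma sum_mono3 (G : fps3 T) n j l m : (j <= n)%N -> (l <= n)%N -> (m <= n)%N ->
  \sum_(a < n.+1) \sum_(b < n.+1) \sum_(c < n.+1) G a b c * mono3 T j l m a b c = G j l m.
Proof.
move=> jn ln mn.
transitivity (\sum_(a < n.+1) (a == j :> nat)%:R * G a l m); last first.
  by rewrite (sum_delta n j (fun a => G a l m)) jn.
apply: eq_bigr => a _.
transitivity (\sum_(b < n.+1) (b == l :> nat)%:R * ((a == j :> nat)%:R * G a b m)); last first.
  by rewrite (sum_delta n l (fun b => (a == j :> nat)%:R * G a b m)) ln.
apply: eq_bigr => b _.
transitivity (\sum_(c < n.+1) (c == m :> nat)%:R * ((b == l :> nat)%:R * ((a == j :> nat)%:R * G a b c))); last first.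
  by rewrite (sum_delta n m (fun c => (b == l :> nat)%:R * ((a == j :> nat)%:R * G a b c))) mn.
by apply: eq_bigr => c _; rewrite mono3E; ring.
Qed.

(** Changing the coordinates at relative weight s affects a term of [A], of weight
    at least k + 1, only from weight k + 1 + s on. *)
Lemma subst3_variation s A A' X Y U X' Y' U' j l m :
    ordw_coords X Y U -> ordw_coords X' Y' U' -> eqw_coords s X Y U X' Y' U' ->
    eqw_coords 1 X' Y' U' (mono3 T 1 0 0) (mono3 T 0 1 0) (mono3 T 0 0 1) ->
    ordw k (k + 1) A -> ordw k (k + 1) A' -> eqw k (k + s) A A' ->
    wt k j l m = (k + s)%N ->
  subst3 A X Y U j l m - subst3 A' X' Y' U' j l m = A j l m - A' j l m.
Proof.
move=> oX oX' XX X1 oA oA' AA wE.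
rewrite -[RHS](@sum_mono3 (fun j l m => A j l m - A' j l m) (j + l + m)); [|lia..].
rewrite /subst3 -sumrB; apply: eq_bigr => a _; rewrite -sumrB; apply: eq_bigr => b _.
rewrite -sumrB; apply: eq_bigr => c _.
case: (ltnP (wt k a b c) (k + 1)) => [lt_k1|ge_k1].
  by rewrite oA // oA' //; ring.
rewrite (eqw_monomial (s := s) oX oX' XX); last by rewrite wE; lia.
rewrite -mulrBl; case: (ltnP (wt k a b c) (k + s)) => [lt_ks|ge_ks].
  by rewrite AA // subrr !mul0r.
rewrite (eqw_monomial_lead oX' X1); last by rewrite wE.
by congr (_ * _); rewrite !mono3E ![nat_of_ord _ == _]eq_sym.
Qed.

(** Although [subst3] truncates its sum, nothing is lost: X^n has no term of
    degree less than n. *)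
Lemma subst3_pow n X Y U j l m : ordw 1 1 X ->
  subst3 (mono3 T n 0 0) X Y U j l m = exp3 X n j l m.
Proof.
move=> oX; case: (leqP n (j + l + m)) => [n_le|n_gt].
  rewrite -[exp3 X n]mul3_1 -[mono3 T 0 0 0 in RHS]mul3_1.
  rewrite -(@sum_mono3 (fun a b c => mul3 (exp3 X a) (mul3 (exp3 Y b) (exp3 U c)) j l m) (j + l + m) n 0 0) //.
  apply: eq_bigr => a _; apply: eq_bigr => b _; apply: eq_bigr => c _.
  by rewrite mulrC.
rewrite (@ordw_exp3 _ 1 1 X n oX); last by rewrite /wt mul1n muln1.
apply: big1 => a _; apply: big1 => b _; apply: big1 => c _.
rewrite /mono3 (_ : (a == n :> nat) = false) ?mul0r //.
by apply/negbTE; have := ltn_ord a; lia.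
Qed.

Lemma subst3D A A' X Y U j l m :
  subst3 (add3 A A') X Y U j l m = subst3 A X Y U j l m + subst3 A' X Y U j l m.
Proof.
rewrite /subst3 -big_split; apply: eq_bigr => a _; rewrite -big_split.
apply: eq_bigr => b _; rewrite -big_split; apply: eq_bigr => c _.
by rewrite /add3 mulrDl.
Qed.

End Substitution.

(** * Uniqueness of the normalizing map *)

Section Uniqueness.
Variables (R : realType) (k : nat).
Hypothesis k_gt2 : (2 < k)%N.
Local Notation ii := (0 +i* 1 : R[i]).
Let k_gt0 : (0 < k)%N. Proof. by lia. Qed.

Definition sub2 (f f' : fps2 R[i]) : fps2 R[i] := fun a b => f a b - f' a b.

Lemma toC3_mono3 a b c : toC3 (mono3 R a b c) = mono3 R[i] a b c.
Proof.
apply/funext => j; apply/funext => l; apply/funext => m.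
by rewrite /toC3 /mono3; case: [&& _, _ & _].
Qed.

Variable P : fps3 R.
Hypothesis P_lead : eqw k k.+1 P (mono3 R k 0 0).
Local Notation Z := (restr_z R).
Local Notation W := (restr_w P).

Lemma ordw_restr_z : ordw k 1 Z.
Proof.
by apply: ordw_add3; last apply: ordw_scale3; apply: ordw_mono3; rewrite /wt.
Qed.

Lemma ordw_lin_w : ordw k k (lin_w ii k).
Proof.
by apply: ordw_add3; last apply: ordw_scale3; apply: ordw_mono3; rewrite /wt; lia.
Qed.

Lemma eqw_restr_w : eqw k k.+1 W (lin_w ii k).
Proof.
move=> j l m lt_k; rewrite /restr_w /lin_w -!toC3_mono3 /add3 /scale3 /toC3.
by rewrite P_lead.
Qed.

Lemma ordw_restr_w : ordw k k W.
Proof. by move=> j l m lt_k; rewrite eqw_restr_w ?ordw_lin_w // ltnW. Qed.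

Lemma ordw_monomial2 a b : ordw k (a + k * b) (mul3 (exp3 Z a) (exp3 W b)).
Proof.
have := ordw_mul3 (ordw_exp3 (n := a) ordw_restr_z) (ordw_exp3 (n := b) ordw_restr_w).
by rewrite muln1 mulnC.
Qed.

(** In a term of df of weight at least n, the products z^a w^b of weight at most
    n only see the leading part u + i x^k of w. *)
Lemma subst2_variation (f f' : fps2 R[i]) n j l m :
    (forall a b, (a + k * b < n)%N -> f a b = f' a b) -> (wt k j l m <= n)%N ->
  subst2 f Z W j l m - subst2 f' Z W j l m = lin_subst ii k (sub2 f f') j l m.
Proof.
move=> ff wE; rewrite /subst2 /lin_subst -sumrB; apply: eq_bigr => a _.
rewrite -sumrB; apply: eq_bigr => b _; rewrite -mulrBl /sub2.
case: (ltnP (a + k * b) n) => [/ff ->|ge_n]; first by rewrite subrr !mul0r.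
congr (_ * _); apply: (@eqw_mul3 _ k a (k * b) 1).
- by have := ordw_exp3 (n := a) ordw_restr_z; rewrite muln1.
- by have := ordw_exp3 (n := a) ordw_restr_z; rewrite muln1.
- by have := ordw_exp3 (n := b) ordw_restr_w; rewrite mulnC.
- by have := ordw_exp3 (n := b) ordw_lin_w; rewrite mulnC.
- by [].
- have := @eqw_exp3 _ k k 1 W (lin_w ii k) b ordw_restr_w ordw_lin_w.
  by rewrite [(b * k)%N]mulnC !addn1; apply; exact: eqw_restr_w.
by rewrite addn1 ltnS (leq_trans wE).
Qed.

Lemma eqw_subst2 (f f' : fps2 R[i]) n :
    (forall a b, (a + k * b < n)%N -> f a b = f' a b) ->
  eqw k n (subst2 f Z W) (subst2 f' Z W).
Proof.
move=> ff j l m lt_n; apply/eqP; rewrite -subr_eq0.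
rewrite (subst2_variation ff (ltnW lt_n)); apply/eqP.
apply: (lin_subst_eq0 _ k_gt0 (n := wt k j l m)) => // a b wE.
by rewrite /sub2 ff ?subrr // wE.
Qed.

Lemma ordw_subst2 s (f : fps2 R[i]) : weight_gt k s f -> ordw k s.+1 (subst2 f Z W).
Proof.
move=> f0 j l m lt_s; apply: big1 => a _; apply: big1 => b _.
have [->|/f0 lt_ab] := eqVneq (f a b) 0; first by rewrite mul0r.
by rewrite ordw_monomial2 ?mulr0 // (leq_trans lt_s).
Qed.

Lemma ordw_re3 s (Q : fps3 R[i]) : ordw k s Q -> ordw k s (re3 Q).
Proof. by move=> Q0 j l m lt_s; rewrite /re3 Q0. Qed.

Lemma ordw_im3 s (Q : fps3 R[i]) : ordw k s Q -> ordw k s (im3 Q).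
Proof. by move=> Q0 j l m lt_s; rewrite /im3 Q0. Qed.

Lemma re_restr_z : re3 Z = mono3 R 1 0 0.
Proof.
apply/funext => j; apply/funext => l; apply/funext => m.
rewrite /re3 /restr_z /add3 /scale3 -!toC3_mono3 /toC3 mulrC ReD Re_mulii /=.
by rewrite oppr0 addr0.
Qed.

Lemma im_restr_z : im3 Z = mono3 R 0 1 0.
Proof.
apply/funext => j; apply/funext => l; apply/funext => m.
rewrite /im3 /restr_z /add3 /scale3 -!toC3_mono3 /toC3 mulrC ImD Im_mulii /=.
by rewrite add0r.
Qed.

Lemma re_restr_w : re3 W = mono3 R 0 0 1.
Proof.
apply/funext => j; apply/funext => l; apply/funext => m.
rewrite /re3 /restr_w /add3 /scale3 -!toC3_mono3 /toC3 mulrC ReD Re_mulii /=.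
by rewrite oppr0 addr0.
Qed.

Lemma eqw_re3_add3 s (Q N : fps3 R[i]) : ordw k s N -> eqw k s (re3 (add3 Q N)) (re3 Q).
Proof. by move=> N0 j l m lt_s; rewrite /re3 /add3 N0 // addr0. Qed.

Lemma eqw_im3_add3 s (Q N : fps3 R[i]) : ordw k s N -> eqw k s (im3 (add3 Q N)) (im3 Q).
Proof. by move=> N0 j l m lt_s; rewrite /im3 /add3 N0 // addr0. Qed.

Definition new_x f := re3 (add3 Z (subst2 f Z W)).
Definition new_y f := im3 (add3 Z (subst2 f Z W)).
Definition new_u g := re3 (add3 W (subst2 g Z W)).

Section OneMap.
Variables (f g : fps2 R[i]).
Hypotheses (f_wt : weight_gt k 1 f) (g_wt : weight_gt k k g).

Lemma ordw_coords_new : ordw_coords k (new_x f) (new_y f) (new_u g).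
Proof.
split; [apply: ordw_re3|apply: ordw_im3|apply: ordw_re3]; apply: ordw_add3.
- exact: ordw_restr_z.
- by apply: ordwW (ordw_subst2 f_wt).
- exact: ordw_restr_z.
- by apply: ordwW (ordw_subst2 f_wt).
- exact: ordw_restr_w.
- by apply: ordwW (ordw_subst2 g_wt).
Qed.

Lemma eqw_coords_new : eqw_coords k 1 (new_x f) (new_y f) (new_u g)
  (mono3 R 1 0 0) (mono3 R 0 1 0) (mono3 R 0 0 1).
Proof.
rewrite -re_restr_z -im_restr_z -re_restr_w; split.
- by apply: eqw_re3_add3; exact: ordw_subst2.
- by apply: eqw_im3_add3; exact: ordw_subst2.
- by rewrite addn1; apply: eqw_re3_add3; exact: ordw_subst2.
Qed.
End OneMap.

Section Step.
Variables (f g f' g' : fps2 R[i]) (A A' : fps3 R).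
Hypotheses (nfg : normalizes k P f g A) (nfg' : normalizes k P f' g' A').

Definition agree_upto s := [/\ forall a b, (a + k * b < s.+1)%N -> f a b = f' a b,
  forall a b, (a + k * b < k + s)%N -> g a b = g' a b & eqw k (k + s) A A'].

(** The difference of the two identities at weight k + s is the linearized
    equation solved by [model_kernel]. *)
Lemma agree_uptoS s : (0 < s)%N -> agree_upto s -> agree_upto s.+1.
Proof.
move=> s_gt0 [ff gg AA].
have [f_wt g_wt [A_wt A_low A_2k1] taken] := nfg.
have [f_wt' g_wt' [A_wt' A_low' A_2k1'] taken'] := nfg'.
have ord_of B : (forall j l m, B j l m != 0 -> (k + 1 <= j + l + k * m)%N) -> ordw k (k + 1) B.
  move=> B0 j l m lt_k; apply/eqP; apply: contraTT lt_k => /B0.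
  by rewrite -leqNgt.
have FF := eqw_subst2 ff; have GG := eqw_subst2 gg.
have XX : eqw_coords k s (new_x f) (new_y f) (new_u g) (new_x f') (new_y f') (new_u g').
  split=> j l m lt_s; rewrite /new_x /new_y /new_u /re3 /im3 /add3.
  - by rewrite FF.
  - by rewrite FF.
  - by rewrite GG.
have oX := ordw_coords_new f_wt g_wt; have oX' := ordw_coords_new f_wt' g_wt'.
have eX := eqw_coords_new f_wt g_wt; have eX' := eqw_coords_new f_wt' g_wt'.
have [g0 f0 A0] : [/\ forall a b, (a + k * b = k + s)%N -> sub2 g g' a b = 0,
      forall a b, (a + k * b = s.+1)%N -> sub2 f f' a b = 0
    & forall j l m, wt k j l m = (k + s)%N -> sub3 A A' j l m = 0].
  apply: model_kernel => //.
  - by move=> j m; rewrite /sub3; have [-> -> -> ->] := A_low j m;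
      have [-> -> -> ->] := A_low' j m; rewrite subrr.
  - by move=> m; rewrite /sub3; have [-> ->] := A_2k1 m;
      have [-> ->] := A_2k1' m; rewrite subrr.
  move=> j l m wE.
  have := congr1 (fun Q : fps3 R => Q j l m) taken.
  have := congr1 (fun Q : fps3 R => Q j l m) taken'.
  rewrite /= -/(new_x f) -/(new_x f') -/(new_y f) -/(new_y f') -/(new_u g) -/(new_u g').
  have ord1 Q : ordw k 1 Q -> ordw 1 1 Q :> Prop.
    by move=> Q0 [|?] [|?] [|?] //= _; apply: Q0; rewrite /wt muln0.
  have ox1 : ordw 1 1 (new_x f) by apply: ord1; case: oX.
  have ox1' : ordw 1 1 (new_x f') by apply: ord1; case: oX'.
  rewrite /hypersurface !subst3D !subst3_pow //.
  move=> E' E.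
  rewrite -(subst2_variation gg) ?wE // ImB.
  have ImE h : complex.Im (subst2 h Z W j l m) =
      im3 (add3 W (subst2 h Z W)) j l m - complex.Im (W j l m).
    by rewrite /im3 /add3 ImD addrC addKr.
  rewrite !ImE E E' opprB addrA subrK.
  rewrite opprD addrACA; congr (_ + _); last first.
    by apply: (subst3_variation oX oX' XX eX') => //; exact: ord_of.
  case: oX => oX _ _; case: oX' => oX' _ _; case: eX => eX _ _; case: eX' => eX' _ _.
  case: XX => XX _ _.
  have kE : k = (k - 1).+1 by lia.
  rewrite {1 2}kE (exp3_variation oX oX' eX eX' XX); last by rewrite wE; lia.
  case: ifP => // le_kj; rewrite -kE; congr (_ * _).
  rewrite -(subst2_variation ff); last by rewrite /wt in wE *; lia.
  by rewrite /new_x /re3 /add3 ReB !ReD; ring.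
split.
- move=> a b; rewrite ltnS leq_eqVlt => /orP[/eqP /f0 /eqP|/ff //].
  by rewrite subr_eq0 => /eqP.
- move=> a b; rewrite addnS ltnS leq_eqVlt => /orP[/eqP /g0 /eqP|/gg //].
  by rewrite subr_eq0 => /eqP.
- move=> j l m; rewrite addnS ltnS leq_eqVlt => /orP[/eqP /A0 /eqP|/AA //].
  by rewrite subr_eq0 => /eqP.
Qed.

Lemma agree_upto1 : agree_upto 1.
Proof.
have [f_wt g_wt [A_wt _ _] _] := nfg; have [f_wt' g_wt' [A_wt' _ _] _] := nfg'.
have low2 (h h' : fps2 R[i]) s : weight_gt k s h -> weight_gt k s h' ->
    forall a b, (a + k * b < s.+1)%N -> h a b = h' a b.
  move=> h_wt h_wt' a b lt_s.
  have [->|/h_wt] := eqVneq (h a b) 0; last by rewrite ltnNge -ltnS lt_s.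
  by have [->|/h_wt'] := eqVneq (h' a b) 0; last by rewrite ltnNge -ltnS lt_s.
split; [exact: low2|by rewrite addn1; exact: low2|].
move=> j l m; rewrite /wt => lt_k.
have [->|/A_wt] := eqVneq (A j l m) 0; last by rewrite leqNgt lt_k.
by have [->|/A_wt'] := eqVneq (A' j l m) 0; last by rewrite leqNgt lt_k.
Qed.

Lemma normalizes_unique : [/\ f = f', g = g' & A = A'].
Proof.
have agree s : agree_upto s.+1.
  by elim: s => [|s IH]; [exact: agree_upto1|exact: agree_uptoS].
split.
- apply/funext => a; apply/funext => b; have [+ _ _] := agree (a + k * b)%N.
  by apply; lia.
- apply/funext => a; apply/funext => b; have [_ + _] := agree (a + k * b)%N.
  by apply; lia.
- apply/funext => j; apply/funext => l; apply/funext => m.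
  by have [_ _] := agree (wt k j l m); apply; lia.
Qed.
End Step.
End Uniqueness.

(** * Coefficients of convergent power series *)

Section Analytic.
Variable R : realType.
Implicit Types (F G : R -> R) (a b c : nat -> R).
Local Open Scope classical_set_scope.

Lemma analytic_coef_bound F a : analytic_at0_with F a ->
  exists C M, [/\ 0 <= C, 0 <= M & forall n, `|a n| <= C * M ^+ n].
Proof.
move=> [r r0 aF]; have r20 : 0 < r / 2 by rewrite divr_gt0.
have : pseries a (r / 2) @ \oo --> F (r / 2).
  by apply: aF; rewrite gtr0_norm // gtr_pMr // invf_lt1 // ltr1n.
move=> /cvgP /cvg_series_bounded /pinfty_ex_gt0[C C0 /= aC].
exists C, (r / 2)^-1; split; [exact: ltW|by rewrite invr_ge0 ltW|move=> n].
have := aC n I; rewrite normrM normrX (gtr0_norm r20) => aCn.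
by rewrite exprVn ler_pdivlMr ?exprn_gt0.
Qed.

Lemma analytic_of_bound b (r C : R) : 0 < r -> (forall n, `|b n| * r ^+ n <= C) ->
  analytic_at0_with (fun x => limn (pseries b x)) b.
Proof.
move=> r0 bC; exists r => // x xr; apply: (@normed_cvg R R).
have C0 : 0 <= C by apply: le_trans (bC 0%N); rewrite expr0 mulr1.
apply: (@series_le_cvg _ _ (geometric C (`|x| / r))) => [n|n|n|] /=.
- exact: normr_ge0.
- by rewrite mulr_ge0 // exprn_ge0 // divr_ge0 // ltW.
- rewrite normrM normrX expr_div_n mulrA ler_pdivlMr ?exprn_gt0 //.
  by rewrite mulrAC ler_wpM2r ?exprn_ge0.
apply: is_cvg_geometric_series.
have xr0 : 0 <= `|x| / r by rewrite divr_ge0 // ltW.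
by rewrite ger0_norm // ltr_pdivrMr // mul1r.
Qed.

Lemma analytic_subX F a k : analytic_at0_with F a ->
  analytic_at0_with (fun x => F x - x ^+ k) (fun n => a n - (n == k)%:R).
Proof.
move=> [r r0 aF]; exists r => // x /aF aFx.
have -> : pseries (fun n => a n - (n == k)%:R) x =
    pseries a x - (fun N => if (k < N)%N then x ^+ k else 0).
  apply/funext => N; rewrite /pseries /series /=.
  rewrite [RHS](_ : _ = \sum_(0 <= i < N) a i * x ^+ i - if (k < N)%N then x ^+ k else 0) //.
  case: N => [|N]; first by rewrite !big_nil subrr.
  rewrite !big_mkord ltnS.
  under eq_bigr do rewrite mulrBl; rewrite sumrB; congr (_ - _).
  by rewrite (sum_delta N k (fun i => x ^+ i)).
apply: cvgB => //; apply: cvg_near_cst; exists k.+1 => // N /= kN.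
by rewrite kN.
Qed.

(** If c_n is the first nonzero coefficient and n <= k, then G(x) = c_n x^n +
    O(x^(n+1)), and dividing by x^n gives |c_n| <= e / 2 + D x for small x. *)
Lemma analytic_small_coef G c k : analytic_at0_with G c ->
    (forall e, 0 < e -> \forall x \near (0 : R), `|G x| <= e * `|x ^+ k|) ->
  forall n, (n <= k)%N -> c n = 0.
Proof.
move=> cG G_small n; have [C [M [C0 M0 cCM]]] := analytic_coef_bound cG.
have [r r0 cGr] := cG.
elim/ltn_ind: n => n IH le_nk.
pose D := 2 * C * M ^+ n.+1.
have D0 : 0 <= D by rewrite !mulr_ge0 ?exprn_ge0.
have tail x N : M * `|x| * 2 <= 1 ->
    `|\sum_(i < N) c (n.+1 + i)%N * x ^+ (n.+1 + i)| <= D * `|x| ^+ n.+1.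
  move=> Mx; have Mx0 : 0 <= M * `|x| by rewrite mulr_ge0.
  apply: le_trans (_ : C * (M * `|x|) ^+ n.+1 * \sum_(i < N) (M * `|x|) ^+ i <= _).
    rewrite mulr_sumr (le_trans (ler_norm_sum _ _ _)) // ler_sum // => i _.
    rewrite -mulrA -exprD exprMn mulrA normrM normrX ler_wpM2r ?exprn_ge0 //.
  have -> : D * `|x| ^+ n.+1 = C * (M * `|x|) ^+ n.+1 * 2 by rewrite /D exprMn; ring.
  by rewrite ler_wpM2l ?mulr_ge0 ?exprn_ge0 // sum_expr_le2 // mulrC.
have bound x : `|x| < r -> M * `|x| * 2 <= 1 ->
    `|G x - c n * x ^+ n| <= D * `|x| ^+ n.+1.
  move=> xr Mx; apply/ler_addgt0Pr => e e0.
  have /cvgrPdist_lt /(_ _ e0) [N _ /(_ (n.+1 + N)%N (leq_addl _ _))] := cGr x xr.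
  rewrite /pseries /series /= big_mkord big_split_ord /= big_ord_recr /=.
  rewrite big1 ?add0r => [dist_lt|i _]; last by rewrite IH ?mul0r // (leq_trans (ltnW _) le_nk).
  have -> : G x - c n * x ^+ n = \sum_(i < N) c (n.+1 + i)%N * x ^+ (n.+1 + i) +
      (G x - (c n * x ^+ n + \sum_(i < N) c (n.+1 + i)%N * x ^+ (n.+1 + i))) by ring.
  by rewrite (le_trans (ler_normD _ _)) // lerD ?tail // ltW.
apply/eqP; rewrite -normr_le0; apply/ler_addgt0Pr => e e0; rewrite add0r.
have e20 : 0 < e / 2 by rewrite divr_gt0.
have [d /= d0 Gd] := G_small _ e20.
(* The four bounds put x where the o-bound holds, inside the radius of
   convergence, where the tail is geometric of ratio at most 1/2, and make D x
   at most e / 2. *)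
pose x := Num.min (Num.min (d / 2) (r / 2)) (Num.min (2 * M + 1)^-1 (e / 2 / (D + 1))).
have M1 : 0 < 2 * M + 1 by rewrite ltr_wpDl ?mulr_ge0.
have D1 : 0 < D + 1 by rewrite ltr_wpDl.
have x0 : 0 < x by rewrite !lt_min !divr_gt0 // invr_gt0 M1.
have : x <= x by []; rewrite {2}/x !le_min => /andP[/andP[xd xr] /andP[xM xD]].
have x1 : x <= 1 by rewrite (le_trans xM) // invf_le1 // lerDr mulr_ge0.
have half_lt (y : R) : 0 < y -> y / 2 < y by move=> y0; rewrite gtr_pMr // invf_lt1 // ltr1n.
have xabs : `|x| = x by rewrite gtr0_norm.
have Mx : M * `|x| * 2 <= 1.
  rewrite xabs; move: xM; rewrite -[leRHS]mul1r ler_pdivlMr //.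
  by move: x0; lra.
have := Gd x; rewrite /= sub0r normrN xabs => /(_ (le_lt_trans xd (half_lt _ d0))).
have := bound x; rewrite xabs => /(_ (le_lt_trans xr (half_lt _ r0))).
rewrite -{1}xabs => /(_ Mx) bx Gx.
rewrite -(ler_pM2r (exprn_gt0 n x0)).
have cE : `|c n| * x ^+ n = `|G x - (G x - c n * x ^+ n)|.
  by rewrite opprB addrC subrK normrM normrX xabs.
rewrite cE (le_trans (ler_normB _ _)) //.
have xk : `|x ^+ k| <= x ^+ n by rewrite normrX xabs ler_wiXn2l // ltW.
have : D * x ^+ n.+1 <= e / 2 * x ^+ n.
  rewrite exprS mulrA ler_wpM2r ?exprn_ge0 ?ltW //.
  move: xD; rewrite ler_pdivlMr //; move: x0; lra.
have : e / 2 * `|x ^+ k| <= e / 2 * x ^+ n by rewrite ler_wpM2l // ltW.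
move: bx Gx; lra.
Qed.

Lemma analytic_tangent_coef F a k : analytic_at0_with F a ->
    (fun x => F x - x ^+ k) =o_ (nbhs (0 : R)) (fun x => x ^+ k) ->
  forall n, (n <= k)%N -> a n = (n == k)%:R.
Proof.
move=> aF /eqoP Fk n le_nk; apply/eqP; rewrite -subr_eq0; apply/eqP.
exact: (analytic_small_coef (analytic_subX k aF)) Fk _ le_nk.
Qed.
End Analytic.

(** * Normalization of a tube *)

Section TubeMap.
Variable R : realType.
Implicit Types (a b : nat -> R) (beta : R).

(** Powers of a tube are powers of one-variable series, computed here on any
    polynomial that agrees with the series to the required order. *)
Lemma exp3_tube (p : {poly R}) N (phi : nat -> R) n j l m :
    (forall i, (i < N)%N -> p`_i = phi i) -> (j < N)%N ->
  exp3 (tube phi) n j l m = if (l == 0)%N && (m == 0)%N then (p ^+ n)`_j else 0.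
Proof.
move=> p_phi; elim: n j l m => [|n IH] j l m jN.
  by rewrite /exp3 /= /mono3 expr0 coef1; case: (j == 0)%N; case: ifP.
rewrite exp3S /mul3; case: ifP => [/andP[/eqP -> /eqP ->]|lm].
  rewrite exprS coefM; apply: eq_bigr => i _.
  rewrite !big_ord1 IH ?(leq_ltn_trans (leq_subr _ _) jN) //=.
  by rewrite /tube /= p_phi // (leq_ltn_trans (leq_ord i)).
apply: big1 => i _; apply: big1 => q _; apply: big1 => r _.
rewrite IH ?(leq_ltn_trans (leq_subr _ _) jN) // /tube.
case: ifP => [/andP[/eqP q0 /eqP r0]|_]; last by rewrite mul0r.
by rewrite q0 r0 !subn0 lm mulr0.
Qed.

Lemma subst3_tube b (X Y U : fps3 R) j l m : subst3 (tube b) X Y U j l m =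
  \sum_(n < (j + l + m).+1) b n * exp3 X n j l m.
Proof.
apply: eq_bigr => n _.
rewrite big_ord_recl /= [X in _ + X]big1 ?addr0 => [|q _]; last first.
  by apply: big1 => r _; rewrite /tube /= mul0r.
rewrite big_ord_recl /= [X in _ + X]big1 ?addr0 => [|r _]; last first.
  by rewrite /tube /= mul0r.
by rewrite /tube /= /exp3 /= !mul3_1.
Qed.

Lemma convergent2_monomial (f : fps2 R[i]) p q :
  (forall p' q', (p', q') != (p, q) -> f p' q' = 0) -> convergent2 f.
Proof.
move=> f0; exists 1 => // z w _ _; rewrite /summable.
rewrite (_ : esum _ _ = \esum_(i in [set (p, q)]) `|(ComplexField.Normc.normc
  (f i.1 i.2 * z ^+ i.1 * w ^+ i.2))%:E|)%E; first by rewrite esum_set1 ?ltry.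
rewrite [RHS]esum_mkcond; apply: eq_esum => -[p' q'] _ /=.
case: ifPn => //; rewrite notin_setE /= => /eqP /f0 ->.
by rewrite !mul0r ComplexField.Normc.normc0 normr0.
Qed.

Section Existence.
Variables (k : nat) (a : nat -> R).
Hypotheses (k_gt2 : (2 < k)%N) (a_lead : forall n, (n <= k)%N -> a n = (n == k)%:R).

(** The value for which [tube_coef_2k1] makes the coefficient of x^(2k-1) vanish. *)
Definition tube_beta : R := - a (2 * k - 1)%N / k%:R.
Local Notation beta := tube_beta.
Local Notation ii := (0 +i* 1 : R[i]).
Local Notation b := (tube_coef a tube_beta).

Definition tube_shear : fps2 R[i] := fun p q =>
  if (p == 0)%N && (q == 1)%N then ii * beta%:C else 0.

Definition tube_remainder : fps3 R := fun j l m => tube b j l m - mono3 R k 0 0 j l m.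

Let a0 : a 0%N = 0. Proof. by rewrite a_lead //; case: k k_gt2. Qed.
Let a1 : a 1%N = 0. Proof. by rewrite a_lead //; case: k k_gt2 => [|[|]]. Qed.
Let a_low i : (i < k)%N -> a i = 0.
Proof. by move=> lt_ik; rewrite a_lead ?ltn_eqF // ltnW. Qed.
Let ak : a k = 1. Proof. by rewrite a_lead // eqxx. Qed.

Lemma tube_coef_lead n : (n <= k)%N -> b n = (n == k)%:R.
Proof.
move=> le_nk; rewrite (@tube_coef_lt _ a beta a0 a1 k) //; [exact: a_lead|lia|lia].
Qed.

Lemma tube_coef_2k1_eq0 : b (2 * k - 1)%N = 0.
Proof.
rewrite (@tube_coef_2k1 _ a beta a0 a1 k) //; last by lia.
rewrite ak /tube_beta expr1n mulr1 mulrC divfK ?subrr //.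
by rewrite pnatr_eq0; lia.
Qed.

Lemma hypersurface_tube_remainder : hypersurface k tube_remainder = tube b.
Proof.
apply/funext => j; apply/funext => l; apply/funext => m.
by rewrite /hypersurface /add3 /tube_remainder addrC subrK.
Qed.

Lemma t_normal_form_tube : t_normal_form k tube_remainder.
Proof.
have offl j l m : (l != 0)%N || (m != 0)%N -> tube_remainder j l m = 0.
  rewrite /tube_remainder /tube /mono3.
  by case: (l == 0)%N; case: (m == 0)%N; rewrite ?andbF ?subrr.
have on j : tube_remainder j 0%N 0%N = b j - (j == k)%:R.
  by rewrite /tube_remainder /tube /mono3 /= andbT.
have low j l m : (j <= k)%N -> tube_remainder j l m = 0.
  move=> le_jk; case: (boolP ((l != 0) || (m != 0))%N) => [/offl //|].
  by rewrite negb_or !negbK => /andP[/eqP -> /eqP ->]; rewrite on tube_coef_lead ?subrr.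
split=> [j l m|j m|m].
- case: (boolP ((l != 0) || (m != 0))%N) => [/offl ->|]; first by rewrite eqxx.
  rewrite negb_or !negbK => /andP[/eqP -> /eqP ->].
  by case: (leqP j k) => [/low ->|]; [rewrite eqxx|lia].
- by split; apply: low; lia.
split; last exact: offl.
case: m => [|m]; last exact: offl.
by rewrite on tube_coef_2k1_eq0 (_ : (_ == _) = false) ?subrr //; lia.
Qed.

Lemma weight_gt_tube_shear : weight_gt k 1 tube_shear.
Proof.
by move=> p q; rewrite /tube_shear; case: ifP; [move=> /andP[/eqP -> /eqP ->]; lia|rewrite eqxx].
Qed.

Lemma subst2_tube_shear (Z W : fps3 R[i]) : W 0%N 0%N 0%N = 0 ->
  subst2 tube_shear Z W = scale3 (ii * beta%:C) W.
Proof.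
move=> W0; apply/funext => j; apply/funext => l; apply/funext => m.
rewrite /subst2 /scale3 /tube_shear.
rewrite big_ord_recl /= [X in _ + X]big1 ?addr0 => [|p _]; last first.
  by apply: big1 => q _; rewrite mul0r.
case: (posnP (j + l + m)) => [d0|].
  have [-> -> ->] : [/\ j = 0, l = 0 & m = 0]%N by split; lia.
  by rewrite big_ord1 /= mul0r W0 mulr0.
case: (j + l + m)%N => [//|d] _.
rewrite 2!big_ord_recl /= [X in _ + (_ + X)]big1 => [|q _]; last by rewrite mul0r.
by rewrite mul0r add0r addr0 /exp3 /= mul3C !mul3_1.
Qed.

(** On the tube, the new x is the series x - beta a(x) and v is unchanged, so the
    claim reduces to b(x - beta a(x)) = a(x). *)
Lemma takes_into_tube : takes_into tube_shear (fun _ _ => 0) (tube a) (tube b).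
Proof.
rewrite /takes_into subst2_tube_shear; last first.
  by rewrite /restr_w /add3 /scale3 /mono3 /toC3 /tube /= a0 mulr0 addr0.
set X := re3 _; set Y := im3 (add3 (restr_z R) _); set U := re3 _.
apply/funext => j; apply/funext => l; apply/funext => m; rewrite subst3_tube.
have -> : im3 (add3 (restr_w (tube a)) (subst2 (fun _ _ => 0) (restr_z R) (restr_w (tube a)))) j l m = tube a j l m.
  rewrite /im3 {1}/add3 /subst2 [X in _ + X]big1 ?addr0 => [|p _]; last first.
    by apply: big1 => q _; rewrite mul0r.
  rewrite /restr_w /add3 /scale3 -toC3_mono3 /toC3 mulrC ImD Im_mulii /=.
  by rewrite add0r.
have XE : X = tube (fun i => (i == 1)%:R - beta * a i).
  apply/funext => p; apply/funext => q; apply/funext => r.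
  rewrite /X /re3 /restr_w /restr_z /add3 /scale3 -!toC3_mono3 /toC3 /tube /mono3 /=.
  by case: (q == 0)%N; case: (r == 0)%N; case: (p == 1)%N; case: (p == 0)%N => /=; ring.
rewrite XE; pose phi := 'X - beta *: trunc (j + l + m).+1 a.
have phiE i : (i < (j + l + m).+1)%N -> phi`_i = (i == 1)%:R - beta * a i.
  by move=> lt_i; rewrite coefB coefX coefZ coef_poly lt_i.
have lt_j : (j < (j + l + m).+1)%N by lia.
under eq_bigr do rewrite (exp3_tube _ _ _ phiE lt_j).
rewrite /tube; case: ifP => _; last by rewrite big1 // => i _; rewrite mulr0.
set N := (j + l + m).+1.
have /dvdXnP /(_ j lt_j) /eqP := tube_coef_comp beta a0 a1 N.
rewrite coefB subr_eq0 coef_poly lt_j => /eqP <-.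
rewrite /comp_poly (@horner_coef_wide _ N); last first.
  by rewrite size_map_polyC size_poly.
rewrite coef_sum; apply: eq_bigr => i _.
by rewrite coef_map coef_poly ltn_ord /= mul_polyC coefZ.
Qed.

Lemma normalizes_tube : normalizes k (tube a) tube_shear (fun _ _ => 0) tube_remainder.
Proof.
split; [exact: weight_gt_tube_shear|by move=> p q; rewrite eqxx|exact: t_normal_form_tube|].
rewrite hypersurface_tube_remainder; exact: takes_into_tube.
Qed.

Lemma tube_lead : eqw k k.+1 (tube a) (mono3 R k 0 0).
Proof.
move=> j l m; rewrite /wt /tube /mono3 => lt_k.
case: (l == 0)%N; case: (m == 0)%N; rewrite ?andbF ?andbT //=.
by rewrite a_lead //; lia.
Qed.

End Existence.
End TubeMap.

Local Open Scope classical_set_scope.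

Theorem corollary5p1 (R : realType) (k : nat) (hk : (2 < k)%N)
    (F : R -> R) (a : nat -> R)
    (hF : analytic_at0_with F a)
    (hFk : (fun x : R => F x - x ^+ k) =o_ (nbhs (0 : R)) (fun x : R => x ^+ k)) :
  exists (f g : fps2 R[i]) (A : fps3 R),
    [/\ normalizes k (tube a) f g A,
        forall (f' g' : fps2 R[i]) (A' : fps3 R),
          normalizes k (tube a) f' g' A' -> [/\ f' = f, g' = g & A' = A],
        convergent2 f, convergent2 g
      & exists (Fs : R -> R) (b : nat -> R),
          analytic_at0_with Fs b /\ hypersurface k A = tube b].
Proof.
have a_lead := analytic_tangent_coef hF hFk.
have norm_a := normalizes_tube hk a_lead.
exists (tube_shear k a), (fun _ _ => 0), (tube_remainder k a); split => //.
- by move=> f' g' A' nA'; apply: normalizes_unique nA' norm_a => //; exact: tube_lead.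
- apply: (@convergent2_monomial _ _ 0 1) => p q.
  by rewrite xpair_eqE /tube_shear => /negPf ->.
- exact: (@convergent2_monomial _ _ 0 0).
exists (fun x => limn (pseries (tube_coef a (tube_beta k a)) x)), (tube_coef a (tube_beta k a)).
split; last exact: hypersurface_tube_remainder.
have [C [M [C0 M0 aCM]]] := analytic_coef_bound hF.
have a0 : a 0%N = 0 by rewrite a_lead ?ltn_eqF //; lia.
have a1 : a 1%N = 0 by rewrite a_lead ?ltn_eqF //; lia.
have [r r0 br] := tube_coef_bound (tube_beta k a) C0 M0 a0 a1 aCM.
exact: analytic_of_bound r0 br.
Qed.
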